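(* Let $R$ be an essentially of finite type algebra over a field $\Bbbk$ and let $\Delta = (\mathfrak{p}_0, \ldots, \mathfrak{p}_n)$ be a flag of prime ideals of $R$. Then the ind-pro completion $C_\Delta R$ of $R$ along $\Delta$ is semilocal (has only finitely many maximal ideals) if and only if $\Delta$ is saturated.
   Context: All rings are commutative with identity. A ring $R$ is an essentially of finite type algebra over a field $\Bbbk$ if $R \cong T^{-1}R'$ for some finite type $\Bbbk$-algebra $R'$ and some multiplicatively closed subset $T \subset R'$. A flag of prime ideals $\Delta = (\mathfrak{p}_0,\ldots,\mathfrak{p}_n)$ of a ring $R$ ($n \ge 0$) is a non-empty finite set of prime ideals with $\mathfrak{p}_i \subsetneq \mathfrak{p}_{i+1}$ for $0 \le i < n$. It is saturated if for every $0\le i<n$ there is no prime ideal strictly between $\mathfrak{p}_i$ and $\mathfrak{p}_{i+1}$. For a prime $\mathfrak{p}$ of $R$ and an $R$-module (or $R$-algebra) $M$, $S^{-1}_{\mathfrak{p}}M$ denotes the localization of $M$ at $\mathfrak{p}$ (inverting the elements of $R\setminus\mathfrak{p}$), and $C_{\mathfrak{p}}M = \varprojlim_l M/\mathfrak{p}^l M$ denotes the $\mathfrak{p}$-adic completion of $M$. For a Noetherian ring $R$ the ind-pro completion of $R$ along $\Delta$ is the ring $$C_\Delta R = C_{\mathfrak{p}_0}S^{-1}_{\mathfrak{p}_0}\cdots C_{\mathfrak{p}_n}S^{-1}_{\mathfrak{p}_n}R$$ (first localize at and complete along $\mathfrak{p}_n$, ..., last along $\mathfrak{p}_0$). *)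

(* Defs.v *)
From HB Require Import structures.
From mathcomp Require Import all_boot all_order all_algebra.
From mathcomp Require Import boolp classical_sets cardinality.
From mathcomp Require Import ring.
From mathcomp Require Import mpoly.

Set Implicit Arguments.
Unset Strict Implicit.
Unset Printing Implicit Defensive.

Import GRing.Theory.
Local Open Scope classical_set_scope.
Local Open Scope ring_scope.
Local Open Scope quotient_scope.

(* Rings are [comPzRingType]s: localizations and completions are built without
   a proof of 1 != 0. An ideal is not required to be proper, since the zeroth
   power of an ideal is the whole ring. *)

Section Ideals.
Variable A : comPzRingType.

Record is_ideal (I : set A) : Prop := IsIdeal {
  is_ideal0 : I 0;
  is_idealD : forall x y, I x -> I y -> I (x + y);
  is_idealM : forall a x, I x -> I (a * x) }.

Record ideal := Ideal { ideal_set :> set A; idealP : is_ideal ideal_set }.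

Definition is_prime_ideal (I : set A) : Prop :=
  [/\ is_ideal I, I <> setT & forall x y, I (x * y) -> I x \/ I y].

Definition is_maximal_ideal (I : set A) : Prop :=
  [/\ is_ideal I, I <> setT
    & forall J : set A, is_ideal J -> I `<=` J -> J = I \/ J = setT].

Record prime_ideal :=
  PrimeIdeal { prime_set :> set A; primeP : is_prime_ideal prime_set }.

Lemma prime_is_ideal (p : prime_ideal) : is_ideal p.
Proof. by case: (primeP p). Qed.

Definition ideal_of_prime (p : prime_ideal) : ideal := Ideal (prime_is_ideal p).

Definition ideal_span_set (X : set A) : set A :=
  [set y | exists2 s : seq (A * A), (forall z, z \in s -> X z.2)
                                  & y = \sum_(z <- s) z.1 * z.2].

Lemma ideal_span_is_ideal X : is_ideal (ideal_span_set X).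
Proof.
split.
- by exists [::] => //; rewrite big_nil.
- move=> _ _ [s Xs ->] [t Xt ->]; exists (s ++ t); last by rewrite big_cat.
  by move=> z; rewrite mem_cat => /orP[/Xs|/Xt].
- move=> a _ [s Xs ->]; exists [seq (a * z.1, z.2) | z <- s].
    by move=> _ /mapP[z /Xs Xz ->].
  by rewrite big_map mulr_sumr; apply: eq_bigr => z _; rewrite mulrA.
Qed.

Definition ideal_span (X : set A) : ideal := Ideal (ideal_span_is_ideal X).

Lemma ideal_span_min (X : set A) (I : ideal) : X `<=` I -> ideal_span X `<=` I.
Proof.
move=> XI _ [s Xs ->]; rewrite big_seq.
apply: (big_ind (ideal_set I)); [exact: is_ideal0 (idealP I) | |].
  exact: is_idealD (idealP I).
by move=> z /Xs /XI; apply: is_idealM (idealP I) _ _.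
Qed.

Lemma sub_ideal_span (X : set A) : X `<=` ideal_span X.
Proof.
move=> x Xx; exists [:: (1, x)]; last by rewrite big_seq1 mul1r.
by move=> z; rewrite inE => /eqP ->.
Qed.

Definition ideal_exp (I : ideal) (l : nat) : ideal :=
  ideal_span [set y | exists2 a : 'I_l -> A,
                  (forall i, ideal_set I (a i)) & y = \prod_i a i].

Lemma ideal_exp_decr (I : ideal) k l : (k <= l)%N ->
  ideal_exp I l `<=` ideal_exp I k.
Proof.
move=> /subnKC <-; apply: ideal_span_min => _ [a Ia ->].
rewrite big_split_ord /= mulrC; apply: (is_idealM (ideal_span_is_ideal _)).
by apply: sub_ideal_span; exists (fun i => a (lshift _ i)).
Qed.

Record mulset := MulSet {
  mulset_set :> set A;
  mulset1 : mulset_set 1;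
  mulsetM : forall s t, mulset_set s -> mulset_set t -> mulset_set (s * t) }.

Definition semilocal : Prop := finite_set [set m : set A | is_maximal_ideal m].

End Ideals.

Section ImageIdeals.
Variables (A B : comPzRingType) (f : {rmorphism A -> B}).

Definition ideal_ext (I : ideal A) : ideal B := ideal_span (f @` I).

Lemma ideal_ext_subset (I J : ideal A) :
  I `<=` J -> ideal_ext I `<=` ideal_ext J.
Proof.
move=> IJ; apply: ideal_span_min => _ [x Ix <-].
by apply: sub_ideal_span; exists x => //; apply: IJ.
Qed.

Definition mulset_img_set (S : mulset A) : set B := f @` S.

Lemma mulset_img1 S : mulset_img_set S 1.
Proof. by exists 1; [exact: mulset1 | rewrite rmorph1]. Qed.

Lemma mulset_imgM S s t :
  mulset_img_set S s -> mulset_img_set S t -> mulset_img_set S (s * t).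
Proof.
move=> [x Sx <-] [y Sy <-]; exists (x * y); last by rewrite rmorphM.
exact: mulsetM.
Qed.

Definition mulset_img (S : mulset A) : mulset B :=
  MulSet (mulset_img1 S) (@mulset_imgM S).

End ImageIdeals.

Section PrimeCompl.
Variables (A : comPzRingType) (p : prime_ideal A).

Lemma prime_compl1 : (~` p) 1.
Proof.
case: (primeP p) => -[_ _ pM] pT _ p1; apply: pT; apply/seteqP; split=> // x _.
by rewrite -[x]mulr1; apply: pM.
Qed.

Lemma prime_complM s t : (~` p) s -> (~` p) t -> (~` p) (s * t).
Proof. by case: (primeP p) => _ _ pP ns nt /pP[]. Qed.

Definition prime_compl : mulset A := MulSet prime_compl1 prime_complM.

End PrimeCompl.

(* The library's ideal quotient needs a proper ideal of a nontrivial ring, so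
   multiplication is put here on its additive quotient. *)
Section RingQuot.
Variables (A : comPzRingType) (I : ideal A).

Definition ideal_pred : A -> bool := fun x => `[< ideal_set I x >].

Lemma ideal_pred_zmod_closed : zmod_closed ideal_pred.
Proof.
case: (idealP I) => I0 ID IM; split=> [|x y]; first exact/asboolP.
move=> /asboolP Ix /asboolP Iy; apply/asboolP; apply: ID => //.
by rewrite -mulN1r; apply: IM.
Qed.

HB.instance Definition _ :=
  GRing.isZmodClosed.Build A ideal_pred ideal_pred_zmod_closed.

Definition ideal_zmod : zmodClosed A := GRing.ZmodClosed.clone A ideal_pred _.

Definition ring_quot : Type := Quotient.quot ideal_zmod.

HB.instance Definition _ := GRing.Zmodule.on ring_quot.
HB.instance Definition _ :=
  EqQuotient.copy ring_quot (Quotient.quot ideal_zmod).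

Lemma ring_quotP x y : reflect (ideal_set I (x - y)) (x == y %[mod ring_quot]).
Proof. by rewrite piE; apply: asboolP. Qed.

Definition ring_quot_one : ring_quot := \pi_ring_quot 1.
Definition ring_quot_mul := lift_op2 ring_quot *%R.

Lemma ring_quot_mul_pi x y :
  ring_quot_mul (\pi_ring_quot x) (\pi_ring_quot y) = \pi_ring_quot (x * y).
Proof.
have IM a u := @is_idealM _ _ (idealP I) a u.
have Irepr a : ideal_set I (repr (\pi_ring_quot a) - a).
  by apply/ring_quotP; rewrite reprK.
unlock ring_quot_mul; apply/eqP/ring_quotP; set x' := repr _; set y' := repr _.
have -> : x' * y' - x * y = y' * (x' - x) + x * (y' - y).
  by rewrite !mulrBr [y' * x']mulrC [y' * x]mulrC addrA subrK.
by apply: (is_idealD (idealP I)); apply: IM; apply: Irepr.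
Qed.

Lemma ring_quot_add_pi x y :
  \pi_ring_quot x + \pi_ring_quot y = \pi_ring_quot (x + y).
Proof. exact: (esym (Quotient.pi_add ideal_zmod x y)). Qed.

Lemma ring_quot_mulA : associative ring_quot_mul.
Proof.
move=> x y z; rewrite -[x]reprK -[y]reprK -[z]reprK.
by rewrite !ring_quot_mul_pi mulrA.
Qed.

Lemma ring_quot_mulC : commutative ring_quot_mul.
Proof.
by move=> x y; rewrite -[x]reprK -[y]reprK !ring_quot_mul_pi mulrC.
Qed.

Lemma ring_quot_mul1 : left_id ring_quot_one ring_quot_mul.
Proof. by move=> x; rewrite -[x]reprK ring_quot_mul_pi mul1r. Qed.

Lemma ring_quot_mulDl : left_distributive ring_quot_mul +%R.
Proof.
move=> x y z; rewrite -[x]reprK -[y]reprK -[z]reprK.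
by rewrite ring_quot_add_pi !ring_quot_mul_pi ring_quot_add_pi mulrDl.
Qed.

HB.instance Definition _ := GRing.Zmodule_isComPzRing.Build ring_quot
  ring_quot_mulA ring_quot_mulC ring_quot_mul1 ring_quot_mulDl.

Definition quot_proj (x : A) : ring_quot := \pi_ring_quot x.

Lemma quot_proj_zmod : zmod_morphism quot_proj.
Proof.
move=> x y; apply/eqP; rewrite eq_sym subr_eq ring_quot_add_pi.
by rewrite subrK.
Qed.

Lemma quot_proj_monoid : monoid_morphism quot_proj.
Proof. by split=> // x y; rewrite /quot_proj -ring_quot_mul_pi. Qed.

HB.instance Definition _ :=
  GRing.isZmodMorphism.Build A ring_quot quot_proj quot_proj_zmod.
HB.instance Definition _ :=
  GRing.isMonoidMorphism.Build A ring_quot quot_proj quot_proj_monoid.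

End RingQuot.

(* Meaningful only when J is contained in I; see [quot_trans_proj]. *)
Definition quot_trans (A : comPzRingType) (J I : ideal A) (x : ring_quot J) :
  ring_quot I := quot_proj I (repr x).

Lemma quot_trans_proj (A : comPzRingType) (J I : ideal A) (x : A) :
  J `<=` I -> quot_trans I (quot_proj J x) = quot_proj I x.
Proof.
move=> JI; apply/eqP/ring_quotP/JI/ring_quotP.
by rewrite reprK.
Qed.

Section Localization.
Variables (A : comPzRingType) (S : mulset A).

Definition denom : choiceType := {s : A | s \in (S : set A)}.

Definition Denom (s : A) (Ss : mulset_set S s) : denom :=
  exist _ s (mem_set Ss).

Lemma denomP (s : denom) : mulset_set S (val s).
Proof. exact: set_mem (valP s). Qed.

Definition denom1 : denom := Denom (mulset1 S).
Definition denomM (s t : denom) : denom :=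
  Denom (mulsetM (denomP s) (denomP t)).

Definition loc_eq (x y : A * denom) : bool :=
  `[< exists2 u, mulset_set S u & u * (x.1 * val y.2 - y.1 * val x.2) = 0 >].

Lemma loc_eq_equiv : equiv_class_of loc_eq.
Proof.
split.
- by move=> x; apply/asboolP; exists 1; [exact: mulset1 | rewrite subrr mulr0].
- suff sym x y : loc_eq x y -> loc_eq y x.
    by move=> x y; apply/idP/idP; apply: sym.
  move=> /asboolP[u Su e]; apply/asboolP; exists u => //.
  by rewrite -opprB mulrN e oppr0.
- move=> y x z /asboolP[u Su /eqP e] /asboolP[v Sv /eqP f]; apply/asboolP.
  exists (val y.2 * (u * v)).
    by apply: mulsetM; [exact: denomP | exact: mulsetM].
  move: e f; rewrite !mulrBr !subr_eq0 => /eqP e /eqP f.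
  apply/eqP; rewrite subr_eq0; apply/eqP.
  have -> : val y.2 * (u * v) * (x.1 * val z.2)
            = (u * (x.1 * val y.2)) * (v * val z.2) by ring.
  rewrite e.
  have -> : u * (y.1 * val x.2) * (v * val z.2)
            = (v * (y.1 * val z.2)) * (u * val x.2) by ring.
  by rewrite f; ring.
Qed.

Canonical loc_eq_equivrel := EquivRelPack loc_eq_equiv.
Canonical loc_eq_encModRel := defaultEncModRel loc_eq.

Definition loc : Type := {eq_quot loc_eq}.

HB.instance Definition _ : EqQuotient _ loc_eq loc := EqQuotient.on loc.
HB.instance Definition _ := Choice.on loc.

Definition lfrac (a : A) (s : denom) : loc := \pi_loc (a, s).

Lemma lfracP a s b t :
  lfrac a s = lfrac b t <->
  exists2 u, mulset_set S u & u * (a * val t - b * val s) = 0.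
Proof.
rewrite /lfrac; split=> [/eqP|h]; last apply/eqP; rewrite piE.
  by move=> /asboolP.
exact/asboolP.
Qed.

Lemma lfrac_repr (x : loc) : x = lfrac (repr x).1 (repr x).2.
Proof. by rewrite /lfrac -surjective_pairing reprK. Qed.

Lemma lfracW (P : loc -> Prop) : (forall a s, P (lfrac a s)) -> forall x, P x.
Proof. by move=> h x; rewrite [x]lfrac_repr. Qed.

Lemma lfrac_eq a s b t : a * val t = b * val s -> lfrac a s = lfrac b t.
Proof.
by move=> e; apply/lfracP; exists 1; [exact: mulset1 | rewrite e subrr mulr0].
Qed.

Definition loc_zero : loc := lfrac 0 denom1.
Definition loc_one : loc := lfrac 1 denom1.
Definition loc_opp := lift_op1 loc (fun x => (- x.1, x.2)).
Definition loc_add := lift_op2 loc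
  (fun x y => (x.1 * val y.2 + y.1 * val x.2, denomM x.2 y.2)).
Definition loc_mul := lift_op2 loc
  (fun x y => (x.1 * y.1, denomM x.2 y.2)).

Lemma loc_reprP a s : exists2 u, mulset_set S u &
  u * ((repr (lfrac a s)).1 * val s) = u * (a * val (repr (lfrac a s)).2).
Proof.
have /lfracP[u Su /eqP] := esym (lfrac_repr (lfrac a s)).
by rewrite mulrBr subr_eq0 => /eqP; exists u.
Qed.

Lemma loc_oppE a s : loc_opp (lfrac a s) = lfrac (- a) s.
Proof.
have [u Su e] := loc_reprP a s; unlock loc_opp.
move: (repr _) e => [b t] /= e; apply/lfracP; exists u => //=.
by rewrite !mulNr -opprD mulrN mulrBr e subrr oppr0.
Qed.

Lemma loc_addE a s b t :
  loc_add (lfrac a s) (lfrac b t) = lfrac (a * val t + b * val s) (denomM s t).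
Proof.
have [u Su e] := loc_reprP a s; have [v Sv f] := loc_reprP b t.
unlock loc_add; move: (repr _) e (repr _) f => [a' s'] /= e [b' t'] /= f.
apply/lfracP; exists (u * v); first exact: mulsetM.
have -> : u * v * ((a' * val t' + b' * val s') * (val s * val t)
    - (a * val t + b * val s) * (val s' * val t'))
  = (u * (a' * val s)) * (v * val t * val t')
    + (v * (b' * val t)) * (u * val s * val s')
    - u * v * (a * val t + b * val s) * (val s' * val t') by ring.
by rewrite e f /=; ring.
Qed.

Lemma loc_mulE a s b t :
  loc_mul (lfrac a s) (lfrac b t) = lfrac (a * b) (denomM s t).
Proof.
have [u Su e] := loc_reprP a s; have [v Sv f] := loc_reprP b t.
unlock loc_mul; move: (repr _) e (repr _) f => [a' s'] /= e [b' t'] /= f.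
apply/lfracP; exists (u * v); first exact: mulsetM.
have -> : u * v * (a' * b' * (val s * val t) - a * b * (val s' * val t'))
  = (u * (a' * val s)) * (v * (b' * val t))
    - u * v * (a * b) * (val s' * val t') by ring.
by rewrite e f /=; ring.
Qed.

Lemma loc_addA : associative loc_add.
Proof.
elim/lfracW=> a s; elim/lfracW=> b t; elim/lfracW=> c u.
by rewrite !loc_addE; apply: lfrac_eq => /=; ring.
Qed.

Lemma loc_addC : commutative loc_add.
Proof.
elim/lfracW=> a s; elim/lfracW=> b t.
by rewrite !loc_addE; apply: lfrac_eq => /=; ring.
Qed.

Lemma loc_add0 : left_id loc_zero loc_add.
Proof. by elim/lfracW=> a s; rewrite loc_addE; apply: lfrac_eq => /=; ring. Qed.

Lemma loc_addN : left_inverse loc_zero loc_opp loc_add.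
Proof.
by elim/lfracW=> a s; rewrite loc_oppE loc_addE; apply: lfrac_eq => /=; ring.
Qed.

HB.instance Definition _ :=
  GRing.isZmodule.Build loc loc_addA loc_addC loc_add0 loc_addN.

Lemma loc_mulA : associative loc_mul.
Proof.
elim/lfracW=> a s; elim/lfracW=> b t; elim/lfracW=> c u.
by rewrite !loc_mulE; apply: lfrac_eq => /=; ring.
Qed.

Lemma loc_mulC : commutative loc_mul.
Proof.
elim/lfracW=> a s; elim/lfracW=> b t.
by rewrite !loc_mulE; apply: lfrac_eq => /=; ring.
Qed.

Lemma loc_mul1 : left_id loc_one loc_mul.
Proof. by elim/lfracW=> a s; rewrite loc_mulE; apply: lfrac_eq => /=; ring. Qed.

Lemma loc_mulDl : left_distributive loc_mul loc_add.
Proof.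
elim/lfracW=> a s; elim/lfracW=> b t; elim/lfracW=> c u.
by rewrite !(loc_mulE, loc_addE); apply: lfrac_eq => /=; ring.
Qed.

HB.instance Definition _ := GRing.Zmodule_isComPzRing.Build loc
  loc_mulA loc_mulC loc_mul1 loc_mulDl.

Definition to_loc (a : A) : loc := lfrac a denom1.

Lemma to_loc_zmod : zmod_morphism to_loc.
Proof.
move=> a b; rewrite -[RHS]/(loc_add _ (loc_opp _)) loc_oppE loc_addE.
by apply: lfrac_eq => /=; ring.
Qed.

Lemma to_loc_monoid : monoid_morphism to_loc.
Proof.
split=> // a b; rewrite -[RHS]/(loc_mul _ _) loc_mulE.
by apply: lfrac_eq => /=; ring.
Qed.

HB.instance Definition _ := GRing.isZmodMorphism.Build A loc to_loc to_loc_zmod.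
HB.instance Definition _ :=
  GRing.isMonoidMorphism.Build A loc to_loc to_loc_monoid.

End Localization.

Definition dep_prod (A : nat -> comPzRingType) : Type := forall l, A l.

Section DepProd.
Variable A : nat -> comPzRingType.
Implicit Types x y z : dep_prod A.

HB.instance Definition _ := gen_eqMixin (dep_prod A).
HB.instance Definition _ := gen_choiceMixin (dep_prod A).

Let prod0 : dep_prod A := fun=> 0.
Let prod1 : dep_prod A := fun=> 1.
Let prodN x : dep_prod A := fun l => - x l.
Let prodD x y : dep_prod A := fun l => x l + y l.
Let prodM x y : dep_prod A := fun l => x l * y l.

Let prodDA : associative prodD.
Proof.
by move=> x y z; apply: functional_extensionality_dep => l; exact: addrA.
Qed.
Let prodDC : commutative prodD.
Proof.
by move=> x y; apply: functional_extensionality_dep => l; exact: addrC.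
Qed.
Let prod0D : left_id prod0 prodD.
Proof.
by move=> x; apply: functional_extensionality_dep => l; exact: add0r.
Qed.
Let prodND : left_inverse prod0 prodN prodD.
Proof.
by move=> x; apply: functional_extensionality_dep => l; exact: addNr.
Qed.

HB.instance Definition _ :=
  GRing.isZmodule.Build (dep_prod A) prodDA prodDC prod0D prodND.

Let prodMA : associative prodM.
Proof.
by move=> x y z; apply: functional_extensionality_dep => l; exact: mulrA.
Qed.
Let prodMC : commutative prodM.
Proof.
by move=> x y; apply: functional_extensionality_dep => l; exact: mulrC.
Qed.
Let prod1M : left_id prod1 prodM.
Proof.
by move=> x; apply: functional_extensionality_dep => l; exact: mul1r.
Qed.
Let prodMDl : left_distributive prodM prodD.
Proof.
by move=> x y z; apply: functional_extensionality_dep => l; exact: mulrDl.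
Qed.

HB.instance Definition _ := GRing.Zmodule_isComPzRing.Build (dep_prod A)
  prodMA prodMC prod1M prodMDl.

End DepProd.

Record filtration (A : comPzRingType) := Filtration {
  filt :> nat -> ideal A;
  filt_decr : forall k l, (k <= l)%N -> filt l `<=` filt k }.

Section InverseLimit.
Variables (A : comPzRingType) (I : filtration A).

(* [invlim] below is the limit of the rings A / I_l inside their product. *)
Definition coherent : {pred dep_prod (fun l => ring_quot (I l))} :=
  fun x => `[< forall k l, (k <= l)%N -> quot_trans (I k) (x l) = x k >].

Lemma quot_trans_rmorph k l (kl : (k <= l)%N) :
  zmod_morphism (@quot_trans A (I l) (I k)) /\
  monoid_morphism (@quot_trans A (I l) (I k)).
Proof.
have E a : quot_trans (I k) (quot_proj (I l) a) = quot_proj (I k) a.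
  exact: quot_trans_proj (filt_decr kl).
split; [|split].
- move=> x y; rewrite -[x]reprK -[y]reprK.
  by rewrite -[X in quot_trans _ X](rmorphB (quot_proj (I l))) !E rmorphB.
- by rewrite -[1 in LHS](rmorph1 (quot_proj (I l))) E rmorph1.
- move=> x y; rewrite -[x]reprK -[y]reprK.
  by rewrite -[X in quot_trans _ X](rmorphM (quot_proj (I l))) !E rmorphM.
Qed.

Lemma coherent_subring : subring_closed coherent.
Proof.
split.
- by apply/asboolP => k l kl; case: (quot_trans_rmorph kl) => _ [].
- move=> x y /asboolP cx /asboolP cy; apply/asboolP => k l kl.
  by have [h _] := quot_trans_rmorph kl; rewrite h cx // cy.
- move=> x y /asboolP cx /asboolP cy; apply/asboolP => k l kl.
  by have [_ [_ h]] := quot_trans_rmorph kl; rewrite h cx // cy.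
Qed.

HB.instance Definition _ := GRing.isSubringClosed.Build
  (dep_prod (fun l => ring_quot (I l))) coherent coherent_subring.

Definition invlim : Type := {x | x \in coherent}.

HB.instance Definition _ := SubChoice.on invlim.
HB.instance Definition _ := GRing.SubChoice_isSubComPzRing.Build
  (dep_prod (fun l => ring_quot (I l))) coherent invlim coherent_subring.

Definition diag (a : A) : dep_prod (fun l => ring_quot (I l)) :=
  fun l => quot_proj (I l) a.

Lemma diag_coherent a : diag a \in coherent.
Proof.
by apply/asboolP => k l kl; apply: quot_trans_proj; apply: filt_decr.
Qed.

Definition to_invlim (a : A) : invlim := exist _ (diag a) (diag_coherent a).

Lemma to_invlim_zmod : zmod_morphism to_invlim.
Proof.
move=> a b; apply: val_inj => /=.
by apply: functional_extensionality_dep => l; apply: rmorphB.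
Qed.

Lemma to_invlim_monoid : monoid_morphism to_invlim.
Proof.
split=> [|a b]; apply: val_inj => //=.
by apply: functional_extensionality_dep => l; apply: rmorphM.
Qed.

HB.instance Definition _ :=
  GRing.isZmodMorphism.Build A invlim to_invlim to_invlim_zmod.
HB.instance Definition _ :=
  GRing.isMonoidMorphism.Build A invlim to_invlim to_invlim_monoid.

End InverseLimit.

(* An R-algebra given by its structure map: the library's algebra structures
   would require the ring to be nontrivial. *)
Record ralg (R : comPzRingType) := RAlg {
  ralg_ring :> comPzRingType;
  ralg_map : {rmorphism R -> ralg_ring} }.

Section IndPro.
Variable R : comPzRingType.
Implicit Types (p : prime_ideal R) (A : ralg R).

(* The elements of R \ p are inverted through the structure map. *)
Definition localization p A : ralg R :=
  let S := mulset_img (ralg_map A) (prime_compl p) in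
  @RAlg R (loc S) (@to_loc A S \o ralg_map A).

Definition adic_filtration p A : filtration A :=
  @Filtration A
    (fun l => ideal_ext (ralg_map A) (ideal_exp (ideal_of_prime p) l))
    (fun k l kl => ideal_ext_subset (@ideal_exp_decr _ _ k l kl)).

Definition completion p A : ralg R :=
  let I := adic_filtration p A in
  @RAlg R (invlim I) (@to_invlim A I \o ralg_map A).

(* [foldr] makes the last prime of the flag act first. *)
Definition ind_pro_completion n (Delta : 'I_n.+1 -> prime_ideal R) : ralg R :=
  foldr (fun p A => completion p (localization p A)) (@RAlg R R idfun)
    [seq Delta i | i <- enum 'I_n.+1].

Definition is_flag n (Delta : 'I_n.+1 -> prime_ideal R) : Prop :=
  forall i j : 'I_n.+1, j = i.+1 :> nat -> Delta i `<` Delta j.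

Definition saturated n (Delta : 'I_n.+1 -> prime_ideal R) : Prop :=
  forall i j : 'I_n.+1, j = i.+1 :> nat ->
    ~ exists q : prime_ideal R, Delta i `<` q /\ q `<` Delta j.

End IndPro.

Definition finite_type (k : fieldType) (A : comAlgType k) : Prop :=
  exists n (phi : {lrmorphism {mpoly k[n]} -> A}),
    forall a, exists f, phi f = a.

Definition ess_finite_type (k : fieldType) (R : comAlgType k) : Prop :=
  exists (A : comAlgType k) (T : mulset A) (phi : {rmorphism loc T -> R}),
    [/\ finite_type A, bijective phi
      & forall c : k, phi (to_loc T c%:A) = c%:A].

(* Main.v *)
(* Saturated flags.  Some subfield [F] of [A = C_(p_i) ... C_(p_n) R] makes
   [A / p_i A] finite-dimensional.  For [i = n], lift a maximal subfield of the
   localization at [p_n].  To go from [i] to [i - 1], take [x] in [p_i] but not in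
   [p_(i-1)]: by saturation [p_i] is nilpotent modulo [(p_(i-1), x)], so modulo
   [p_(i-1)] the complete ring [A] is spanned by finitely many elements over the
   power series [F[[x]]]; localizing at [p_(i-1)] inverts [x], and the fractions of
   [F[[x]]] form the next subfield.  A ring that is finite over a field modulo an
   ideal contained in its radical is semilocal.

   Unsaturated flags.  Let [p_i < q < p_(i+1)], take [x] in [q] but not in [p_i],
   [y] in [p_(i+1)] but not in [q], a lacunary series [f = sum_j y^(E j)], and
   [b_c = x - y^c f].  As [R] is an increasing union of finite-dimensional spaces,
   Krull's intersection theorem lets [E] grow so fast that an element of [R]
   divisible by [b_c] is divisible by almost all truncations of [b_c]; these are
   pairwise comaximal once [y] is inverted, so the element vanishes.  Modulo
   countably many ideals simultaneously, this shows that no [b_c] becomes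
   invertible in [C_Delta R], where the differences [b_c - b_c'] are units: the
   [b_c] lie in distinct maximal ideals. *)

From HB Require Import structures.
Require Import Defs.
From mathcomp Require Import all_boot all_algebra.
From mathcomp Require Import boolp classical_sets cardinality.
From mathcomp Require Import ring zify.
From mathcomp Require Import mpoly.

Set Implicit Arguments.
Unset Strict Implicit.
Unset Printing Implicit Defensive.

Import GRing.Theory.
Local Open Scope classical_set_scope.
Local Open Scope ring_scope.

(** * Ideals and Noetherian rings *)

(** Noetherian arguments are made over [R] only; no completion is shown to be Noetherian or flat.
    Facts about a completion are brought down to [R] by contraction: an element of [R] in the ideal
    generated by [b] and [I] upstairs lies, for every [M] and up to a denominator, in the one
    generated by [b] and [I + p^M] one level below, and Krull's theorem then removes [p^M]. Each
    descent thus replaces one ideal by infinitely many, so the unsaturated case must treat all the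
    ideals [p_0] plus sums of powers of the [p_j] at once; they are countable, and a diagonal choice
    of [E] serves them all. The truncations of [b_c] must stay non-units after inverting [y]. The
    prime [q] guarantees this for [x], as [x] is in [q] and [y] is not. It passes to all truncations
    through an Artin-Rees bound ([delays]) whose constant [e] never grows, because every exponent
    exceeds it. *)

Lemma course_of_values (T : Type) (f : seq T -> T) :
  exists a : nat -> T, forall n, a n = f (mkseq a n).
Proof.
pose pre := fix pre n := if n is n'.+1 then rcons (pre n') (f (pre n')) else [::].
pose a n := f (pre n); have E n : pre n = mkseq a n.
  by elim: n => [//|n IHn]; rewrite mkseqS -IHn.
by exists a => n; rewrite -E.
Qed.

Section IdealTheory.
Variable R : comPzRingType.
Implicit Types (I J : set R) (x y z : R).

Lemma ideal_zero I : is_ideal I -> I 0. Proof. by case. Qed.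
Lemma ideal_add I : is_ideal I -> forall x y, I x -> I y -> I (x + y).
Proof. by case. Qed.
Lemma ideal_mul I : is_ideal I -> forall a x, I x -> I (a * x).
Proof. by case. Qed.
Lemma ideal_mulr I : is_ideal I -> forall a x, I x -> I (x * a).
Proof. by move=> iI a x Ix; rewrite mulrC; apply: ideal_mul. Qed.
Lemma ideal_opp I : is_ideal I -> forall x, I x -> I (- x).
Proof. by move=> iI x Ix; rewrite -mulN1r; apply: ideal_mul. Qed.
Lemma ideal_sub I : is_ideal I -> forall x y, I x -> I y -> I (x - y).
Proof. by move=> iI x y Ix Iy; apply: ideal_add => //; apply: ideal_opp. Qed.
Lemma ideal_sum I : is_ideal I -> forall (T : Type) (r : seq T) (P : pred T) F,
  (forall i, P i -> I (F i)) -> I (\sum_(i <- r | P i) F i).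
Proof.
by move=> iI T r P F IF; apply: big_ind => //; [exact: ideal_zero|exact: ideal_add].
Qed.
Lemma ideal_eq I : is_ideal I -> forall x y, I (x - y) -> I y -> I x.
Proof. by move=> iI x y Ixy Iy; rewrite -(subrK y x); apply: ideal_add. Qed.

Lemma ideal_setT I : is_ideal I -> I 1 -> I = setT.
Proof.
by move=> iI I1; apply/seteqP; split=> // x _; rewrite -[x]mulr1; apply: ideal_mul.
Qed.

(** [add_gen I x] is [I + (x)] and [add_ideal I J] is [I + J], written as congruences modulo [I] so
    that membership reduces to ring identities. *)
Definition add_gen I x : set R := [set z | exists a, I (z - a * x)].
Definition add_ideal I J : set R := [set z | exists2 y, J y & I (z - y)].

Lemma add_gen_ideal I x : is_ideal I -> is_ideal (add_gen I x).
Proof.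
move=> iI; split; first by exists 0; rewrite mul0r subrr; apply: ideal_zero.
- move=> u v [a Ha] [b Hb]; exists (a + b).
  by rewrite (_ : _ - _ = (u - a * x) + (v - b * x)); [apply: ideal_add|ring].
- move=> c u [a Ha]; exists (c * a).
  by rewrite -mulrA -mulrBr; apply: ideal_mul.
Qed.

Lemma add_ideal_ideal I J : is_ideal I -> is_ideal J -> is_ideal (add_ideal I J).
Proof.
move=> iI iJ; split; first by exists 0; [exact: ideal_zero|rewrite subrr; exact: ideal_zero].
- move=> u v [a Ja Ha] [b Jb Hb]; exists (a + b); first exact: ideal_add.
  by rewrite (_ : _ - _ = (u - a) + (v - b)); [apply: ideal_add|ring].
- move=> c u [a Ja Ha]; exists (c * a); first exact: ideal_mul.
  by rewrite -mulrBr; apply: ideal_mul.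
Qed.

Lemma sub_add_gen I x : I `<=` add_gen I x.
Proof. by move=> z Iz; exists 0; rewrite mul0r subr0. Qed.

Lemma add_gen_gen I x : is_ideal I -> forall a, add_gen I x (a * x).
Proof. by move=> iI a; exists a; rewrite subrr; apply: ideal_zero. Qed.

Lemma sub_add_ideall I J : is_ideal J -> I `<=` add_ideal I J.
Proof. by move=> iJ z Iz; exists 0; [exact: ideal_zero | rewrite subr0]. Qed.

Lemma sub_add_idealr I J : is_ideal I -> J `<=` add_ideal I J.
Proof. by move=> iI z Jz; exists z; last by rewrite subrr; exact: ideal_zero. Qed.

Definition fgen I := exists w (g : 'I_w -> R), (forall i, I (g i)) /\
  forall x, I x -> exists c : 'I_w -> R, x = \sum_i c i * g i.

Definition lspan (s : seq R) : set R :=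
  [set x | exists c : nat -> R, x = \sum_(i < size s) c i * s`_i].

Lemma lspan_ideal s : is_ideal (lspan s).
Proof.
split; first by exists (fun=> 0); rewrite big1 // => i _; rewrite mul0r.
- move=> x y [c ->] [d ->]; exists (fun i => c i + d i).
  by rewrite -big_split; apply: eq_bigr => i _; rewrite mulrDl.
- move=> a x [c ->]; exists (fun i => a * c i).
  by rewrite mulr_sumr; apply: eq_bigr => i _; rewrite mulrA.
Qed.

Lemma mem_lspan s i : (i < size s)%N -> lspan s s`_i.
Proof.
move=> si; exists (fun j => (i == j)%:R).
rewrite (bigD1 (Ordinal si)) //= eqxx mul1r big1 ?addr0 // => j /eqP ne.
by case: eqP => [e|]; [case: ne; apply: val_inj | rewrite mul0r].
Qed.

Lemma lspan_min s I : is_ideal I -> (forall i, (i < size s)%N -> I s`_i) ->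
  lspan s `<=` I.
Proof.
move=> iI Is x [c ->]; apply: ideal_sum => // i _; apply: ideal_mul => //.
exact: Is.
Qed.

Lemma lspan_fgen s : fgen (lspan s).
Proof.
exists (size s), (fun i : 'I__ => s`_i); split=> [i|x [c ->]].
  exact: mem_lspan.
by exists (fun i : 'I__ => c i).
Qed.

End IdealTheory.

(** * Noetherian rings and Hilbert's basis theorem *)

Definition noeth (R : comPzRingType) := forall I : set R, is_ideal I -> fgen I.

(** The spans of the initial segments increase to an ideal; once they contain its finitely many
    generators, the next term is redundant. *)
Lemma noeth_seq (R : comPzRingType) : noeth R -> forall a : nat -> R,
  exists N (c : nat -> R), a N = \sum_(i < N) c i * a i.
Proof.
move=> nR a; pose I := [set x | exists N, lspan (mkseq a N) x].
have mono N M : (N <= M)%N -> lspan (mkseq a N) `<=` lspan (mkseq a M).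
  move=> NM; apply: lspan_min; first exact: lspan_ideal.
  move=> i; rewrite size_mkseq => iN; rewrite nth_mkseq //.
  rewrite -(nth_mkseq 0 a (leq_trans iN NM)); apply: mem_lspan.
  by rewrite size_mkseq (leq_trans iN NM).
have iI : is_ideal I.
  split; first by exists 0; apply: ideal_zero; apply: lspan_ideal.
  - move=> x y [N HN] [M HM]; exists (maxn N M).
    apply: ideal_add; first exact: lspan_ideal.
      by apply: mono HN; rewrite leq_maxl.
    by apply: mono HM; rewrite leq_maxr.
  - by move=> b x [N HN]; exists N; apply: ideal_mul => //; apply: lspan_ideal.
have [w [g [gI gen]]] := nR I iI.
have [Ni HNi] := choice gI.
pose N := \max_i Ni i.
have HN i : lspan (mkseq a N) (g i) by apply: mono (HNi i); apply: leq_bigmax.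
have /gen[c aN] : I (a N).
  exists N.+1; rewrite -(nth_mkseq 0 a (ltnSn N)); apply: mem_lspan.
  by rewrite size_mkseq.
have [d] : lspan (mkseq a N) (a N).
  rewrite aN; apply: ideal_sum; first exact: lspan_ideal.
  by move=> i _; apply: ideal_mul => //; apply: lspan_ideal.
rewrite size_mkseq => e; exists N, d; rewrite e.
by apply: eq_bigr => i _; rewrite nth_mkseq.
Qed.

(** Every element of [B] is a fraction [f a / f s], a hypothesis that covers quotients and
    localizations together; generators of the contracted ideal then generate. *)
Lemma noeth_image (A B : comPzRingType) (f : {rmorphism A -> B}) :
  (forall b, exists a s u, f s * u = 1 /\ b * f s = f a) -> noeth A -> noeth B.
Proof.
move=> surj nA I iI; pose I' := f @^-1` I.
have iI' : is_ideal I'.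
  split; rewrite /I' /preimage /=; first by rewrite rmorph0; apply: ideal_zero.
  - by move=> x y; rewrite rmorphD; apply: ideal_add.
  - by move=> x y; rewrite rmorphM; apply: ideal_mul.
have [w [g [gI gen]]] := nA _ iI'.
exists w, (f \o g); split=> [i|b Ib]; first exact: gI.
have [a [s [u [su e]]]] := surj b.
have /gen[c ea] : I' a by rewrite /I' /preimage /= -e; apply: ideal_mulr.
exists (fun i => u * f (c i)).
rewrite -[b]mulr1 -su mulrA e ea rmorph_sum mulr_suml; apply: eq_bigr => i _.
by rewrite /= rmorphM; ring.
Qed.

Lemma noeth_field (k : fieldType) : noeth k.
Proof.
move=> I iI; have [[x Ix x0]|H] := pselect (exists2 x, I x & x != 0).
  exists 1%N, (fun=> x); split=> // y Iy; exists (fun=> y / x).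
  by rewrite big_ord1 divfK.
exists 0%N, (fun=> 0); split=> [[]//|y Iy]; exists (fun=> 0); rewrite big_ord0.
by apply/eqP/negPn/negP => y0; apply: H; exists y.
Qed.

(** Hilbert's argument: each [a n] has least degree among the elements of [I] outside the ideal
    generated by its predecessors. *)
Lemma noeth_poly (R : comNzRingType) : noeth R -> noeth {poly R}.
Proof.
move=> nR I iI; apply: contrapT => nfg.
have ex s : exists f, (forall i, (i < size s)%N -> I s`_i) ->
    [/\ I f, ~ lspan s f &
      forall h, I h -> ~ lspan s h -> (size f <= size h)%N].
  have [sI|nsI] := pselect (forall i, (i < size s)%N -> I s`_i); last by exists 0.
  pose P n := `[< exists f, [/\ I f, ~ lspan s f & size f = n] >].
  have exP : exists n, P n.
    apply: contrapT => nP; apply: nfg.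
    rewrite (_ : I = lspan s); first exact: lspan_fgen.
    apply/seteqP; split; last exact: lspan_min.
    move=> f If; apply: contrapT => nf; apply: nP; exists (size f).
    by apply/asboolP; exists f.
  case: (ex_minnP exP) => n /asboolP[f [If nf <-]] minf.
  exists f => _; split=> // h Ih nh; apply: minf.
  by apply/asboolP; exists h.
have [F HF] := choice ex.
have [a ea] := course_of_values F.
have aI n : I (a n).
  elim/ltn_ind: n => n IHn; rewrite ea; case: (HF (mkseq a n)) => // i.
  by rewrite size_mkseq => ilt; rewrite nth_mkseq //; apply: IHn.
have {}HF n : [/\ I (a n), ~ lspan (mkseq a n) (a n) &
      forall h, I h -> ~ lspan (mkseq a n) h -> (size (a n) <= size h)%N].
  rewrite ea; apply: HF => i; rewrite size_mkseq => ilt.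
  by rewrite nth_mkseq.
have sub i n : (i <= n)%N -> lspan (mkseq a i) `<=` lspan (mkseq a n).
  move=> lin; apply: lspan_min; first exact: lspan_ideal.
  move=> j; rewrite size_mkseq => ji; rewrite nth_mkseq //.
  rewrite -(nth_mkseq 0 a (leq_trans ji lin)); apply: mem_lspan.
  by rewrite size_mkseq (leq_trans ji lin).
have sz i n : (i <= n)%N -> (size (a i) <= size (a n))%N.
  move=> lin; have [_ _ mi] := HF i; have [In nn _] := HF n.
  by apply: mi => // /(sub _ _ lin).
have [N [c eN]] := noeth_seq nR (fun n => lead_coef (a n)).
have [IN nN mN] := HF N.
(* A relation among leading coefficients makes [h] lose the top term of [a N], while [h] stays
   outside the span of the earlier terms. *)
pose h := a N - \sum_(i < N) c i *: ('X^(size (a N) - size (a i)) * a i).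
have aN0 : a N != 0.
  by apply/eqP => e; apply: nN; rewrite e; apply: ideal_zero; apply: lspan_ideal.
have aspan i : (i < N)%N -> lspan (mkseq a N) (a i).
  move=> iN; rewrite -(nth_mkseq 0 a iN); apply: mem_lspan.
  by rewrite size_mkseq.
have Ih : I h.
  apply: ideal_sub => //; apply: ideal_sum => // i _.
  by rewrite -mul_polyC; apply: ideal_mul => //; apply: ideal_mul.
have nh : ~ lspan (mkseq a N) h.
  move=> Hh; apply: nN; rewrite -[a N](subrK (\sum_(i < N) c i *: ('X^(size (a N) - size (a i)) * a i))).
  apply: ideal_add => //; first exact: lspan_ideal.
  apply: ideal_sum; first exact: lspan_ideal.
  move=> i _; rewrite -mul_polyC; do 2 (apply: ideal_mul; first exact: lspan_ideal).
  exact: aspan.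
have := mN h Ih nh.
suff : (size h <= (size (a N)).-1)%N.
  have : (0 < size (a N))%N by rewrite size_poly_gt0.
  by lia.
have saN : (0 < size (a N))%N by rewrite size_poly_gt0.
apply/leq_sizeP => j; rewrite /h coefB coef_sum => jge.
have [jeq|jne] := eqVneq j (size (a N)).-1.
  rewrite jeq -[(a N)`_ _]/(lead_coef (a N)) eN -sumrB big1 // => i _.
  rewrite coefZ coefXnM; case: ltnP => [|le].
    have [-> |ai0] := eqVneq (a i) 0; first by rewrite lead_coef0 mulr0 subrr.
    by have := sz i N (ltnW (ltn_ord i)); move: ai0; rewrite -size_poly_gt0; lia.
  have [-> |ai0] := eqVneq (a i) 0; first by rewrite lead_coef0 coef0 mulr0 subrr.
  rewrite lead_coefE (_ : _ - (_ - _) = (size (a i)).-1)%N ?subrr //.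
  by have := sz i N (ltnW (ltn_ord i)); move: ai0; rewrite -size_poly_gt0; lia.
have {}jge : (size (a N) <= j)%N by rewrite -(prednK saN) ltn_neqAle eq_sym jne.
rewrite nth_default //.
rewrite big1 ?subr0 // => i _; rewrite coefZ coefXnM; case: ltnP => _; rewrite ?mulr0 //.
rewrite nth_default ?mulr0 //; by rewrite -{1}(subKn (sz i N (ltnW (ltn_ord i)))) leq_sub2r.
Qed.

(** Sending the polynomial variable to the last ['X_i] makes [{mpoly k[n.+1]}] an image of [{poly
    {mpoly k[n]}}]. *)
Lemma noeth_mpoly (k : fieldType) n : noeth {mpoly k[n]}.
Proof.
elim: n => [|n IHn].
  apply: (noeth_image (f := (@mpolyC 0 k))) (@noeth_field k) => p.
  exists p@_0%MM, 1, 1; rewrite !rmorph1 !mulr1; split=> //.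
  by apply/mpolyP => m; rewrite mcoeffC; case: eqP => [->|]; rewrite ?mulr1 //;
     case; apply/mnmP; case.
pose x : {mpoly k[n.+1]} := 'X_ord_max.
have cfu : commr_rmorph (@mwiden n k) x by move=> p; apply: mulrC.
apply: (noeth_image (f := horner_morph cfu)) (noeth_poly IHn) => p.
suff [q ->] : exists q, p = horner_morph cfu q.
  by exists q, 1, 1; rewrite !rmorph1 !mulr1.
have ex1 i : exists q, ('X_i : {mpoly k[n.+1]}) = horner_morph cfu q.
  have [j ->|->] := unliftP ord_max i; last by exists 'X; rewrite horner_morphX.
  exists ('X_j)%:P; rewrite horner_morphC /= mwidenX mnmwiden1; congr 'X_[U_(_)].
  by apply: val_inj; rewrite /= /bump leqNgt ltn_ord.
rewrite [p]mpolyE; elim/big_rec: _ => [|m q _ [q' ->]].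
  by exists 0; rewrite rmorph0.
suff [r ->] : exists r, ('X_[m] : {mpoly k[n.+1]}) = horner_morph cfu r.
  exists ((p@_m)%:MP%:P * r + q').
  by rewrite rmorphD rmorphM /= horner_morphC /= mwidenC mul_mpolyC.
rewrite mpolyXE_id; elim/big_rec: _ => [|i t _ [r ->]].
  by exists 1; rewrite rmorph1.
have [s ->] := ex1 i.
by exists (s ^+ m i * r); rewrite rmorphM rmorphXn.
Qed.

Notation expI I l := (ideal_set (ideal_exp I l)).

(** * Prime ideals and Krull's intersection theorem *)

Section MaximalIdeals.
Variable R : comPzRingType.
Implicit Types (I J Q : set R) (x y z : R).

(** [S] is arbitrary, so that one Zorn argument yields both primes avoiding a multiplicative set
    and, for [S = {1}], maximal ideals. *)
Lemma ideal_avoiding J (S : set R) : is_ideal J -> (forall x, J x -> ~ S x) ->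
  exists Q, [/\ is_ideal Q, J `<=` Q, forall x, Q x -> ~ S x &
    forall Q', is_ideal Q' -> Q `<=` Q' -> (forall x, Q' x -> ~ S x) -> Q' = Q].
Proof.
move=> iJ JS.
(* The empty set is allowed so that the empty chain has an upper bound. *)
pose P (Q : set R) := Q = set0 \/
  [/\ is_ideal Q, J `<=` Q & forall x, Q x -> ~ S x].
have [|Q [PQ maxQ]] := @Zorn_bigcup R P.
  move=> F FP Ftot; have [[K FK K0]|none] := pselect (exists2 K, F K & K !=set0);
    last first.
    left; apply/seteqP; split=> // x [K FK Kx]; case: none; exists K => //.
    by exists x.
  right.
  have good K' : F K' -> forall x, K' x ->
      [/\ is_ideal K', J `<=` K' & forall x, K' x -> ~ S x].
    by move=> FK' x K'x; case: (FP _ FK') => // e; rewrite e in K'x.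
  have [k Kk] := K0; have [iK JK _] := good _ FK _ Kk.
  split; first split.
  - by exists K => //; apply: ideal_zero.
  - move=> x y [A FA Ax] [B FB By].
    have [iA _ _] := good _ FA _ Ax; have [iB _ _] := good _ FB _ By.
    case: (Ftot _ _ FA FB) => sub.
      by exists B => //; apply: ideal_add => //; apply: sub.
    by exists A => //; apply: ideal_add => //; apply: sub.
  - move=> a x [A FA Ax]; exists A => //; have [iA _ _] := good _ FA _ Ax.
    exact: ideal_mul.
  - by move=> x /JK Kx; exists K.
  - by move=> x [A FA Ax]; have [_ _] := good _ FA _ Ax; apply.
have [iQ JQ QS] : [/\ is_ideal Q, J `<=` Q & forall x, Q x -> ~ S x].
  case: PQ => // Q0; exfalso; apply: (maxQ J); last by right; split.
  rewrite Q0; split; first exact: sub0set.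
  by move=> /(_ 0 (ideal_zero iJ)).
exists Q; split=> // Q' iQ' sub dis; apply: contrapT => ne.
apply: (maxQ Q'); last by right; split=> // x /JQ; apply: sub.
by rewrite properEneq; split=> //; apply/eqP => e; apply: ne.
Qed.

Lemma prime_avoiding J (S : set R) : is_ideal J -> S 1 ->
  (forall x y, S x -> S y -> S (x * y)) -> (forall x, J x -> ~ S x) ->
  exists Q : prime_ideal R, J `<=` Q /\ forall x, prime_set Q x -> ~ S x.
Proof.
move=> iJ S1 SM JS; have [Q [iQ JQ QS maxQ]] := ideal_avoiding iJ JS.
have meets x : ~ Q x -> exists a, exists2 q, Q q & S (q + a * x).
  move=> nQx; apply: contrapT => none; apply: nQx.
  rewrite -(maxQ (add_gen Q x)); first by rewrite -[x in add_gen _ _ x]mul1r; apply: add_gen_gen.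
  - exact: add_gen_ideal.
  - exact: sub_add_gen.
  - move=> z [a Qz] Sz; apply: none; exists a, (z - a * x) => //.
    by rewrite subrK.
have pQ : is_prime_ideal Q.
  split=> //; first by move=> QT; apply: (QS 1) => //; rewrite QT.
  move=> x y Qxy; apply: contrapT => /not_orP[/meets[a [q Qq Sx]] /meets[b [r Qr Sy]]].
  apply: QS (SM _ _ Sx Sy).
  rewrite (_ : _ * _ = q * (r + b * y) + a * x * r + a * b * (x * y)); last by ring.
  by apply: ideal_add => //; [apply: ideal_add => //; [exact: ideal_mulr|exact: ideal_mul]|exact: ideal_mul].
by exists (PrimeIdeal pQ).
Qed.

Lemma maximal_containing x : (forall u, u * x <> 1) ->
  exists2 m : set R, is_maximal_ideal m & m x.
Proof.
move=> nu.
have i0 : is_ideal [set 0 : R].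
  by split=> // [a b -> ->|a b ->]; rewrite /= ?addr0 ?mulr0.
have [|Q [iQ JQ QS maxQ]] :=
    @ideal_avoiding (add_gen [set 0] x) [set 1] (add_gen_ideal x i0).
  by move=> _ /= [a /subr0_eq ->]; apply: nu.
exists Q; last by apply: JQ; rewrite -[x in add_gen _ _ x]mul1r; apply: add_gen_gen.
split=> //; first by move=> QT; apply: (QS 1) => //; rewrite QT.
move=> J iJ sub; have [J1|nJ1] := pselect (J 1); [right|left].
  exact: ideal_setT.
by apply: maxQ => // y Jy y1; apply: nJ1; rewrite -y1.
Qed.

Lemma maximal_prime (m : set R) : is_maximal_ideal m -> is_prime_ideal m.
Proof.
case=> im mT mmax; split=> // x y mxy; apply: contrapT => /not_orP[nx ny].
have ex z : ~ m z -> exists a, m (1 - a * z).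
  move=> nz; have [e|e] := mmax (add_gen m z) (add_gen_ideal z im) (@sub_add_gen _ m z).
    by case: nz; rewrite -e -[z in add_gen _ _ z]mul1r; apply: add_gen_gen.
  by have : add_gen m z 1 by rewrite e.
have [a ma] := ex _ nx; have [b mb] := ex _ ny.
apply: mT; apply: ideal_setT => //.
rewrite (_ : 1 = (1 - a * x) + a * x * (1 - b * y) + a * b * (x * y)); last by ring.
by apply: ideal_add => //; [apply: ideal_add => //; exact: ideal_mul|exact: ideal_mul].
Qed.

End MaximalIdeals.

Section Powers.
Variable R : comPzRingType.
Implicit Types (I J : ideal R) (x y z : R).

Lemma expI_ideal I l : is_ideal (expI I l).
Proof. exact: idealP. Qed.

Lemma expI0 I x : expI I 0 x.
Proof.
rewrite -[x]mulr1; apply: ideal_mul; first exact: expI_ideal.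
by apply: sub_ideal_span; exists (fun=> 0); [case|rewrite big_ord0].
Qed.

Lemma expIS I l x y : ideal_set I y -> expI I l x -> expI I l.+1 (y * x).
Proof.
move=> Iy; apply: (@ideal_span_min _ _ (Ideal (_ : is_ideal [set x | expI I l.+1 (y * x)]))).
  split=> /=; first by rewrite mulr0; apply: ideal_zero; apply: expI_ideal.
  - by move=> a b; rewrite mulrDr; apply: ideal_add; apply: expI_ideal.
  - by move=> a b; rewrite mulrCA; apply: ideal_mul; apply: expI_ideal.
move=> iK _ [a Ia ->]; apply: sub_ideal_span => /=.
exists (fun i => oapp a y (unlift ord0 i)) => [i|].
  by case: unliftP => [j _|_] /=.
rewrite big_ord_recl unlift_none /=; congr (_ * _).
by apply: eq_bigr => i _; rewrite liftK.
Qed.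

Lemma expIS_min I l (K : set R) : is_ideal K ->
  (forall y x, ideal_set I y -> expI I l x -> K (y * x)) -> expI I l.+1 `<=` K.
Proof.
move=> iK IK; apply: (@ideal_span_min _ _ (Ideal iK)) => _ [a Ia ->].
rewrite big_ord_recl; apply: IK => //.
by apply: sub_ideal_span; exists (fun i => a (lift ord0 i)).
Qed.

Lemma expIM I k l x y :
  expI I k x -> expI I l y -> expI I (k + l) (x * y).
Proof.
move=> + Iy; elim: k x => [|k IHk] x.
  by move=> _; apply: ideal_mul => //; apply: expI_ideal.
have iK : is_ideal [set x | expI I (k.+1 + l) (x * y)].
  split=> /=; first by rewrite mul0r; apply: ideal_zero; apply: expI_ideal.
  - by move=> a b; rewrite mulrDl; apply: ideal_add; apply: expI_ideal.
  - by move=> a b; rewrite -mulrA; apply: ideal_mul; apply: expI_ideal.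
apply: (expIS_min iK) => u v Iu Iv /=.
by rewrite -mulrA addSn; apply: expIS => //; apply: IHk.
Qed.

Lemma expIX I n x : ideal_set I x -> expI I n (x ^+ n).
Proof.
move=> Ix; elim: n => [|n IHn]; first exact: expI0.
by rewrite exprS; apply: expIS.
Qed.

Lemma expI1 I x : expI I 1 x <-> ideal_set I x.
Proof.
split=> [|Ix]; last by rewrite -[x]expr1; apply: expIX.
by apply: expIS_min; [exact: idealP|move=> y z Iy _; apply: ideal_mulr => //; exact: idealP].
Qed.

Lemma expI_sub I J l : I `<=` J -> expI I l `<=` expI J l.
Proof.
move=> IJ; elim: l => [|l IHl]; first by move=> x _; apply: expI0.
apply: expIS_min; first exact: expI_ideal.
by move=> y x /IJ Jy /IHl; apply: expIS.
Qed.

(** A product of [N + M] elements of [J + (a)] expands into terms with at least [N] factors [a] or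
    at least [M] factors in [J]. *)
Lemma expI_add_gen I J a : I `<=` add_gen J a -> forall N M,
  expI I (N + M) `<=` add_gen (expI J M) (a ^+ N).
Proof.
move=> IJ N M; move El: (N + M)%N => l; elim: l N M El => [|l IHl] [|N] [|M] // El.
- by move=> x _; exists 0; apply: expI0.
- by move=> x _; exists x; rewrite mulr1 subrr; apply: ideal_zero; apply: expI_ideal.
- by move=> x _; exists 0; apply: expI0.
have iK := add_gen_ideal (a ^+ N.+1) (expI_ideal J M.+1).
apply: expIS_min => // y x /IJ[c Jc] Ix.
have [|d Hd] := IHl N M.+1 _ _ Ix; first by lia.
have [|e He] := IHl N.+1 M _ _ Ix; first by lia.
exists (c * d + (y - c * a) * e).
rewrite (_ : _ - _ = c * a * (x - d * a ^+ N) +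
   (y - c * a) * (x - e * a ^+ N.+1)); last by rewrite exprS; ring.
apply: ideal_add; [exact: expI_ideal|apply: ideal_mul => //; exact: expI_ideal|].
exact: expIS.
Qed.

End Powers.

Section Saturation.
Variable R : comPzRingType.
Implicit Types (p : prime_ideal R) (I J : set R) (x y z : R).

Lemma primeM p x y : prime_set p (x * y) -> prime_set p x \/ prime_set p y.
Proof. by case: (Defs.primeP p) => _ _; apply. Qed.

Lemma prime_nM p x y : ~ prime_set p x -> ~ prime_set p y -> ~ prime_set p (x * y).
Proof. exact: prime_complM. Qed.

Lemma prime_n1 p : ~ prime_set p 1. Proof. exact: prime_compl1. Qed.

Lemma prime_nX p x n : ~ prime_set p x -> ~ prime_set p (x ^+ n).
Proof.
move=> nx; elim: n => [|n IHn]; first exact: prime_n1.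
by rewrite exprS; apply: prime_nM.
Qed.

Lemma prime_sub p x y : ~ prime_set p x -> prime_set p y -> ~ prime_set p (x - y).
Proof.
move=> nx py pxy; apply: nx; rewrite -(subrK y x).
by apply: ideal_add => //; apply: prime_is_ideal.
Qed.

Lemma prime_add p x y : ~ prime_set p x -> prime_set p y -> ~ prime_set p (x + y).
Proof.
move=> nx py; rewrite -[y]opprK; apply: prime_sub => //.
by apply: ideal_opp => //; apply: prime_is_ideal.
Qed.

(* The contraction to [R] of the extension of [I] to the localization at [p]. *)
Definition psat p I : set R := [set r | exists2 s, ~ prime_set p s & I (s * r)].

Lemma psat_ideal p I : is_ideal I -> is_ideal (psat p I).
Proof.
move=> iI; split.
- by exists 1; [exact: prime_n1 | rewrite mulr0; exact: ideal_zero].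
- move=> x y [s ns Ix] [t nt Iy]; exists (s * t); first exact: prime_nM.
  rewrite mulrDr; apply: ideal_add => //; last by rewrite -mulrA; apply: ideal_mul.
  by rewrite mulrAC; apply: ideal_mulr.
- by move=> a x [s ns Ix]; exists s => //; rewrite mulrCA; apply: ideal_mul.
Qed.

Lemma sub_psat p I : I `<=` psat p I.
Proof. by move=> x Ix; exists 1; [exact: prime_n1|rewrite mul1r]. Qed.

Lemma psatS p I J : I `<=` J -> psat p I `<=` psat p J.
Proof. by move=> IJ x [s ns /IJ]; exists s. Qed.

Lemma psat_mono p (q : prime_ideal R) I : p `<=` q -> psat q I `<=` psat p I.
Proof. by move=> pq x [s ns Is]; exists s => // /pq. Qed.

Lemma psatM p I s r : is_ideal I -> ~ prime_set p s -> psat p I (s * r) -> psat p I r.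
Proof.
move=> iI ns [t nt]; rewrite mulrA => H; exists (t * s) => //.
exact: prime_nM.
Qed.

Lemma psat_id p I : is_ideal I -> psat p (psat p I) `<=` psat p I.
Proof. by move=> iI r [s ns]; apply: psatM. Qed.

Lemma psat_prime p : psat p p `<=` p.
Proof. by move=> r [s ns /primeM[]]. Qed.

End Saturation.

Section Krull.
Variable R : comPzRingType.
Hypothesis nR : noeth R.
Implicit Types (p : prime_ideal R) (I J : set R) (x y z : R).

Lemma fgen_lspan I : is_ideal I -> exists s, I = lspan s.
Proof.
move=> iI; have [w [g [gI gen]]] := nR iI.
exists (codom g); apply/seteqP; split=> [x /gen[c ->]|].
  apply: ideal_sum; first exact: lspan_ideal.
  move=> i _; apply: ideal_mul; first exact: lspan_ideal.
  have lt : (enum_rank i < size (codom g))%N by rewrite size_codom.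
  have := mem_lspan lt; rewrite (nth_map i); last by rewrite -cardE.
  by rewrite nth_enum_rank.
apply: lspan_min => // i; rewrite size_codom => lt.
rewrite (nth_map (enum_val (Ordinal lt))); last by rewrite -cardE.
exact: gI.
Qed.

(** The ideals [(I : y^j)] increase, so their union is reached at a finite stage. *)
Lemma colon_stable I y : is_ideal I ->
  exists e, forall j t, I (y ^+ j * t) -> I (y ^+ e * t).
Proof.
move=> iI; pose U := [set t | exists j, I (y ^+ j * t)].
have up j k t : (j <= k)%N -> I (y ^+ j * t) -> I (y ^+ k * t).
  by move=> /subnK <-; rewrite exprD -mulrA => ?; apply: ideal_mul.
have iU : is_ideal U.
  split; first by exists 0%N; rewrite mulr0; apply: ideal_zero.
  - move=> s t [j Hj] [k Hk]; exists (maxn j k); rewrite mulrDr; apply: ideal_add => //.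
      by apply: up Hj; rewrite leq_maxl.
    by apply: up Hk; rewrite leq_maxr.
  - by move=> a t [j Hj]; exists j; rewrite mulrCA; apply: ideal_mul.
have [w [g [gU gen]]] := nR iU; have [j Hj] := choice gU.
exists (\max_i j i) => k t Ik; have /gen[c ->] : U t by exists k.
rewrite mulr_sumr; apply: ideal_sum => // i _.
by rewrite mulrCA; apply: ideal_mul => //; apply: up (Hj i); apply: leq_bigmax.
Qed.

(* Write [s_k g = y^(e+k) c_k] modulo [I], where [e] stabilises [(I : y^j)].
   Then the [d_k = y^e c_k] satisfy [s_k' d_k = s_k y^(k'-k) d_k'], and a
   linear relation expressing some [d_N] through its predecessors reads
   [(s_N - y u) d_N = 0], where [s_N - y u] lies outside [p]. *)
Lemma krull_principal p I y g : is_ideal I -> prime_set p y ->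
  (forall N, psat p (add_gen I (y ^+ N)) g) -> psat p I g.
Proof.
move=> iI py Hg; have [e He] := colon_stable y iI.
have ex k : exists sc, ~ prime_set p sc.1 /\ I (sc.1 * g - sc.2 * y ^+ (e + k)).
  by have [s ns [c H]] := Hg (e + k)%N; exists (s, c).
have [sc Hsc] := choice ex; pose s k := (sc k).1; pose c k := (sc k).2.
have ns k : ~ prime_set p (s k) by case: (Hsc k).
have Ik k : I (s k * g - c k * y ^+ (e + k)) by case: (Hsc k).
pose d k := y ^+ e * c k.
have dI k m : I (s (k + m)%N * d k - s k * y ^+ m * d (k + m)%N).
  rewrite (_ : _ - _ = y ^+ e * (s (k + m)%N * c k - s k * y ^+ m * c (k + m)%N)); last first.
    by rewrite /d; ring.
  apply: (He (e + k)%N).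
  rewrite (_ : _ * _ = s k * (s (k + m)%N * g - c (k + m)%N * y ^+ (e + (k + m))) -
     s (k + m)%N * (s k * g - c k * y ^+ (e + k))); last by rewrite !exprD; ring.
  by apply: ideal_sub => //; apply: ideal_mul.
have [N [a eN]] := noeth_seq nR d.
pose u := \sum_(k < N) a k * s k * y ^+ (N - k.+1).
have Iu : I ((s N - y * u) * d N).
  rewrite mulrBl {1}eN [y * u]mulrC /u !mulr_sumr !mulr_suml -sumrB.
  apply: ideal_sum => // k _.
  have := dI k (N - k)%N; rewrite subnKC 1?ltnW // => H.
  rewrite (_ : _ - _ = a k * (s N * d k - s k * y ^+ (N - k) * d N)); last first.
    have -> : (N - k = (N - k.+1).+1)%N by rewrite subnSK.
    by rewrite exprS; ring.
  exact: ideal_mul.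
exists ((s N - y * u) * s N).
  apply: prime_nM => //; apply: prime_sub => //.
  by apply: ideal_mulr => //; apply: prime_is_ideal.
rewrite -mulrA; apply: (ideal_eq iI (y := (s N - y * u) * (d N * y ^+ N))).
  rewrite -mulrBr; apply: ideal_mul => //.
  rewrite (_ : _ - _ = s N * g - c N * y ^+ (e + N)) //.
  by rewrite /d exprD; ring.
by rewrite mulrA; apply: ideal_mulr.
Qed.

Lemma add_gen_lspan (a : R) (s : seq R) :
  lspan (a :: s) `<=` add_gen (Ideal (lspan_ideal s)) a.
Proof.
move=> _ [c ->]; rewrite big_ord_recl /=; exists (c 0%N).
by rewrite [X in X - _]addrC addrK; exists (fun i => c i.+1); apply: eq_bigr.
Qed.

(** Induction on generators [a :: L] of [p]: since [(a, L)^(N+M)] lies in [(a^N) + (L)^M], the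
    induction hypothesis for [I + (a^N)] removes [(L)^M], and the principal case removes [a^N]. *)
Lemma krull p I g : is_ideal I ->
  (forall M, psat p (add_ideal I (expI (ideal_of_prime p) M)) g) ->
  psat p I g.
Proof.
move=> iI Hg; have [L eL] := fgen_lspan (prime_is_ideal p).
have Lp i : (i < size L)%N -> prime_set p L`_i by move=> lt; rewrite eL; apply: mem_lspan.
have {}Hg M : psat p (add_ideal I (expI (Ideal (lspan_ideal L)) M)) g.
  apply: psatS (Hg M) => z [y Jy Iy]; exists y => //.
  by apply: expI_sub Jy; rewrite /= eL.
elim: L I iI Lp Hg {eL} => [|a L IHL] I iI Lp Hg.
  have [s ns [y Jy Iy]] := Hg 1%N; exists s => //.
  move/expI1: Jy => /= -[c e]; move: Iy; rewrite e big_ord0 subr0 //.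
apply: (@krull_principal p I a) => //; first exact: (Lp 0%N).
move=> N; apply: IHL; first exact: add_gen_ideal.
  by move=> i lt; apply: (Lp i.+1).
move=> M; apply: psatS (Hg (N + M)%N) => z [y Jy Iy].
have [c Hc] := @expI_add_gen _ (Ideal (lspan_ideal (a :: L))) _ a (@add_gen_lspan a L) N M y Jy.
by exists (y - c * a ^+ N) => //; exists c; rewrite opprB addrA addrAC addrK.
Qed.

(** One generator at a time: if [a^n] and [(L)^M] lie in [Q], so does [(a, L)^(n+M)]. *)
Lemma pow_sub (I : ideal R) Q : is_ideal Q ->
  (forall x, ideal_set I x -> exists n, Q (x ^+ n)) -> exists N, expI I N `<=` Q.
Proof.
move=> iQ; have [L eL] := fgen_lspan (idealP I).
move=> IQ; have {}IQ i : (i < size L)%N -> exists n, Q (L`_i ^+ n).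
  by move=> lt; apply: IQ; rewrite /= eL; apply: mem_lspan.
suff [N HN] : exists N, expI (Ideal (lspan_ideal L)) N `<=` Q.
  by exists N => z Iz; apply: HN; apply: expI_sub Iz; rewrite /= -eL.
elim: L IQ {eL} => [|a L IHL] IQ.
  exists 1%N => z /expI1 /= [c ->]; rewrite big_ord0; exact: ideal_zero.
have [n Hn] := IQ 0%N isT.
have [|M HM] := IHL; first by move=> i lt; apply: (IQ i.+1).
exists (n + M)%N => z Jz.
have [c Hc] := @expI_add_gen _ (Ideal (lspan_ideal (a :: L))) _ a (@add_gen_lspan a L) n M z Jz.
rewrite -[z](subrK (c * a ^+ n)); apply: ideal_add => //; first exact: HM.
exact: ideal_mul.
Qed.

(** After localizing at [p], saturation leaves [p] as the only prime over [p' + (x)], so each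
    element of [p] has a power in that ideal. *)
Lemma saturated_pow (p' p : prime_ideal R) x : p' `<` p ->
  (~ exists q : prime_ideal R, p' `<` q /\ q `<` p) -> prime_set p x -> ~ prime_set p' x ->
  exists N, expI (ideal_of_prime p) N `<=` psat p (add_gen p' x).
Proof.
move=> pp' sat px npx.
have iJ := add_gen_ideal x (prime_is_ideal p').
apply: pow_sub; first exact: psat_ideal.
move=> z /= pz; apply: contrapT => none.
(* A prime avoiding [S] lies inside [p] (take [n = 0]) and misses [z] (take [s = 1]). *)
pose S := [set t | exists s n, ~ prime_set p s /\ t = s * z ^+ n].
have [|||q [Jq qS]] := prime_avoiding (S := S) iJ.
- by exists 1, 0%N; rewrite mulr1; split=> //; apply: prime_n1.
- move=> _ _ [s [n [ns ->]]] [t [m [nt ->]]]; exists (s * t), (n + m)%N.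
  by split; [exact: prime_nM|rewrite exprD; ring].
- by move=> t Jt [s [n [ns e]]]; apply: none; exists n, s => //; rewrite -e.
apply: sat; exists q; split.
  split; first by move=> t Jt; apply: Jq; apply: sub_add_gen.
  move=> /(_ x) h; apply/npx/h/Jq; rewrite -[x in add_gen _ _ x]mul1r.
  by apply: add_gen_gen; apply: prime_is_ideal.
split.
  move=> t qt; apply: contrapT => nt; apply: (qS t qt).
  by exists t, 0%N; rewrite mulr1.
by move=> /(_ z pz) qz; apply: (qS z qz); exists 1, 1%N; rewrite mul1r; split=> //; apply: prime_n1.
Qed.

End Krull.

(** * Localizations and completions *)

Section ExtendedIdeals.
Variables (A B : comPzRingType) (f : {rmorphism A -> B}).

Lemma mem_ext (I : ideal A) x : ideal_set I x -> ideal_set (ideal_ext f I) (f x).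
Proof. by move=> Ix; apply: sub_ideal_span; exists x. Qed.

Lemma ext_min (I : ideal A) (K : set B) : is_ideal K ->
  (forall x, ideal_set I x -> K (f x)) -> ideal_ext f I `<=` K.
Proof.
by move=> iK H; apply: (@ideal_span_min _ _ (Ideal iK)) => _ [x Ix <-]; apply: H.
Qed.

Lemma ext_expM (I : ideal A) k l x y :
  ideal_set (ideal_ext f (ideal_exp I k)) x ->
  ideal_set (ideal_ext f (ideal_exp I l)) y ->
  ideal_set (ideal_ext f (ideal_exp I (k + l))) (x * y).
Proof.
move=> + Jy; set J := ideal_ext f (ideal_exp I (k + l)).
have iJ : is_ideal J := idealP J.
have iK : is_ideal [set x | ideal_set J (x * y)].
  split=> /=; first by rewrite mul0r; apply: ideal_zero.
  - by move=> a b; rewrite mulrDl; apply: ideal_add.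
  - by move=> a b; rewrite -mulrA; apply: ideal_mul.
apply: (ext_min iK) => u Iu /=; move: y Jy {iK}.
have iK : is_ideal [set y | ideal_set J (f u * y)].
  split=> /=; first by rewrite mulr0; apply: ideal_zero.
  - by move=> a b; rewrite mulrDr; apply: ideal_add.
  - by move=> a b; rewrite mulrCA; apply: ideal_mul.
apply: (ext_min iK) => v Iv /=; rewrite -rmorphM.
exact: (mem_ext (expIM Iu Iv)).
Qed.

End ExtendedIdeals.

Section LocalizationTheory.
Variables (R : comPzRingType) (p : prime_ideal R) (A : ralg R).

Definition loc_map : {rmorphism A -> localization p A} :=
  @to_loc A (mulset_img (ralg_map A) (prime_compl p)).

Lemma loc_map_ralg r : ralg_map (localization p A) r = loc_map (ralg_map A r).
Proof. by []. Qed.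

Lemma loc_unit s : ~ prime_set p s ->
  exists u, u * ralg_map (localization p A) s = 1.
Proof.
move=> ns; have Ss : mulset_set (mulset_img (ralg_map A) (prime_compl p)) (ralg_map A s).
  by exists s.
exists (lfrac 1 (Denom Ss)).
rewrite loc_map_ralg -[LHS]/(loc_mul _ _) loc_mulE; apply: lfrac_eq.
by rewrite /=; ring.
Qed.

Lemma loc_num (d : localization p A) :
  exists s a, ~ prime_set p s /\ ralg_map (localization p A) s * d = loc_map a.
Proof.
elim/lfracW: d => a t; have [s ns e] := denomP t.
exists s, a; split=> //; rewrite loc_map_ralg e.
rewrite -[LHS]/(loc_mul _ _) loc_mulE; apply: lfrac_eq.
by rewrite /=; ring.
Qed.

Lemma loc_zeroP a : loc_map a = 0 -> exists2 s, ~ prime_set p s & ralg_map A s * a = 0.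
Proof.
move=> /lfracP[_ [s ns <-]] /= e; exists s => //.
by rewrite -e; ring.
Qed.

End LocalizationTheory.

(** * Adic completions: convergence, units and power series *)

Section CompletionTheory.
Variables (R : comPzRingType) (p : prime_ideal R) (D : ralg R).
Local Notation P := (ideal_of_prime p).
Local Notation C := (completion p D).
Local Notation "'I_( l )" := (ideal_set (ideal_ext (ralg_map D) (ideal_exp P l))).

Definition comp_map : {rmorphism D -> C} := @to_invlim D (adic_filtration p D).

Lemma comp_map_ralg r : ralg_map C r = comp_map (ralg_map D r).
Proof. by []. Qed.

Definition comp_proj (l : nat) (a : C) : ring_quot (adic_filtration p D l) := sval a l.

(* The kernel of the projection to [D / p^l D]. *)
Definition cker (l : nat) : set C := [set a | comp_proj l a = 0].

Lemma comp_projD l a b : comp_proj l (a + b) = comp_proj l a + comp_proj l b.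
Proof. by []. Qed.
Lemma comp_projN l a : comp_proj l (- a) = - comp_proj l a.
Proof. by []. Qed.
Lemma comp_projM l a b : comp_proj l (a * b) = comp_proj l a * comp_proj l b.
Proof. by []. Qed.
Lemma comp_proj_map l d : comp_proj l (comp_map d) = quot_proj _ d.
Proof. by []. Qed.

Lemma quot_proj_eq0 (A : comPzRingType) (I : ideal A) x :
  quot_proj I x = 0 <-> ideal_set I x.
Proof.
rewrite -(rmorph0 (quot_proj I)); split.
  by move=> /eqP/ring_quotP; rewrite subr0.
by move=> Ix; apply/eqP/ring_quotP; rewrite subr0.
Qed.

Lemma cker_ideal l : is_ideal (cker l).
Proof.
split=> [//|x y Hx Hy|a x Hx].
  by rewrite /cker /mkset comp_projD Hx Hy addr0.
by rewrite /cker /mkset comp_projM Hx mulr0.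
Qed.

Lemma cker_map l d : cker l (comp_map d) <-> 'I_(l) d.
Proof. exact: quot_proj_eq0. Qed.

Lemma cker_approx l (a : C) : exists d, cker l (a - comp_map d).
Proof.
exists (repr (comp_proj l a)); rewrite /cker /mkset comp_projD comp_projN comp_proj_map.
by rewrite /quot_proj reprK subrr.
Qed.

Lemma cker_decr k l : (k <= l)%N -> cker l `<=` cker k.
Proof.
move=> kl a; rewrite /cker /mkset => al.
have /asboolP/(_ k l kl) := svalP a; rewrite -/(comp_proj l a) -/(comp_proj k a) => <-.
rewrite al -(rmorph0 (quot_proj _)).
by rewrite (quot_trans_proj _ (filt_decr (f := adic_filtration p D) kl)) rmorph0.
Qed.

Lemma cker_sep a : (forall l, cker l a) -> a = 0.
Proof.
move=> H; apply: val_inj; apply: functional_extensionality_dep => l.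
exact: (H l).
Qed.

Lemma cker_cauchy (e : nat -> D) : (forall l, 'I_(l) (e l.+1 - e l)) ->
  exists a, forall l, cker l (a - comp_map (e l)).
Proof.
move=> He; pose x : dep_prod (fun l => ring_quot (adic_filtration p D l)) :=
  fun l => quot_proj _ (e l).
have cx : x \in coherent (I := adic_filtration p D).
  apply/asboolP => k l kl; rewrite /x.
  rewrite (quot_trans_proj _ (filt_decr (f := adic_filtration p D) kl)).
  apply/eqP; rewrite -subr_eq0 -rmorphB; apply/eqP/quot_proj_eq0.
  elim: l kl => [|l IHl]; first by rewrite leqn0 => /eqP ->; rewrite subrr; apply: ideal_zero; apply: idealP.
  rewrite leq_eqVlt => /orP[/eqP ->|kl]; first by rewrite subrr; apply: ideal_zero; apply: idealP.
  rewrite -(subrK (e l) (e l.+1)) -addrA; apply: ideal_add; first exact: idealP.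
    exact: (filt_decr (f := adic_filtration p D) (kl : (k <= l)%N) (He l)).
  exact: IHl.
exists (exist _ x cx) => l; rewrite /cker /mkset comp_projD comp_projN.
by rewrite comp_proj_map subrr.
Qed.

Lemma ckerM k l x y : cker k x -> cker l y -> cker (k + l) (x * y).
Proof.
move=> kx ly.
have [d Hd] := cker_approx (k + l) x; have [e He] := cker_approx (k + l) y.
have iK := cker_ideal.
have Id : 'I_(k) d.
  apply/cker_map; rewrite -[X in cker k X](subKr x); apply: ideal_sub => //.
  by apply: cker_decr Hd; rewrite leq_addr.
have Ie : 'I_(l) e.
  apply/cker_map; rewrite -[X in cker l X](subKr y); apply: ideal_sub => //.
  by apply: cker_decr He; rewrite leq_addl.
rewrite (_ : x * y = (x - comp_map d) * y + comp_map d * (y - comp_map e) +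
  comp_map (d * e)); last by rewrite rmorphM; ring.
apply: ideal_add => //.
  by apply: ideal_add => //; [apply: ideal_mulr|apply: ideal_mul].
by apply/cker_map; apply: ext_expM.
Qed.

Lemma ckerX l x : cker 1 x -> cker l (x ^+ l).
Proof.
move=> x1; elim: l => [|l IHl]; last by rewrite exprS; apply: (ckerM (k := 1)).
have [d Hd] := cker_approx 0 (x ^+ 0); rewrite -(subrK (comp_map d) (x ^+ 0)).
apply: ideal_add => //; first exact: cker_ideal.
apply/cker_map; rewrite -[d]mulr1; apply: ideal_mul; first exact: idealP.
by rewrite -(rmorph1 (ralg_map D)); apply: mem_ext; apply: expI0.
Qed.

Lemma cker0 x : cker 0 x.
Proof.
rewrite -[x]mulr1; apply: ideal_mul; first exact: cker_ideal.
by apply: (@ckerX 0 0); rewrite /cker.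
Qed.

Lemma cker_ext l : ideal_ext (ralg_map C) (ideal_exp P l) `<=` cker l.
Proof.
apply: ext_min; first exact: cker_ideal.
by move=> x Ix; rewrite comp_map_ralg; apply/cker_map; apply: mem_ext.
Qed.

Lemma cker_sub : forall e : nat -> C, (forall l, cker l (e l.+1 - e l)) ->
  exists a, forall l, cker l (a - e l).
Proof.
move=> e He; have iK := cker_ideal.
have [d Hd] := choice (fun l => cker_approx l (e l)).
have [l|a Ha] := cker_cauchy (e := d).
  apply/cker_map; rewrite rmorphB.
  rewrite (_ : _ - _ = (e l - comp_map (d l)) - (e l.+1 - comp_map (d l.+1)) +
    (e l.+1 - e l)); last by ring.
  apply: ideal_add => //; apply: ideal_sub => //.
  by apply: cker_decr (Hd l.+1).
exists a => l; rewrite (_ : _ - _ = (a - comp_map (d l)) - (e l - comp_map (d l))).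
  by apply: ideal_sub.
by ring.
Qed.

(* The solution is phi_m = sum_j a_(m+j) x_m ... x_(m+j-1). *)
Lemma nested_series (a x : nat -> C) : (forall m, cker 1 (x m)) ->
  exists phi, forall m, phi m = a m + x m * phi m.+1.
Proof.
move=> x1; have iK := cker_ideal.
pose t := fix t l m := if l is l'.+1 then a m + x m * t l' m.+1 else 0.
have tE l m : t l.+1 m = a m + x m * t l m.+1 by [].
have tS l m : cker l (t l.+1 m - t l m).
  elim: l m => [|l IHl] m; first exact: cker0.
  rewrite [X in cker _ X](_ : _ = x m * (t l.+1 m.+1 - t l m.+1)); last first.
    by rewrite (tE l.+1 m) {1}(tE l m); ring.
  exact: (ckerM (k := 1)).
have [phi Hphi] := choice (fun m => cker_sub (fun l => tS l m)).
exists phi => m; apply/eqP; rewrite -subr_eq0; apply/eqP/cker_sep => l.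
rewrite (_ : _ - _ = (phi m - t l.+1 m) - x m * (phi m.+1 - t l m.+1)); last first.
  by rewrite tE; ring.
apply: ideal_sub => //; first by apply: cker_decr (Hphi m l.+1).
exact: ideal_mul.
Qed.

(** Uniqueness for the recursion of [nested_series]: unrolling [l] times puts each [d m] in
    [cker l]. *)
Lemma nested_zero (x d : nat -> C) : (forall m, cker 1 (x m)) ->
  (forall m, d m = x m * d m.+1) -> forall m, d m = 0.
Proof.
move=> x1 dE m; apply: cker_sep => l.
elim: l m => [|l IHl] m; first exact: cker0.
by rewrite dE; apply: (ckerM (k := 1)).
Qed.

(** The geometric series: with constant data [nested_series] gives [phi m = 1 + x * phi m.+1], and
    uniqueness makes [phi] constant. *)
Lemma cker1_unit x : cker 1 x -> exists u, u * (1 - x) = 1.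
Proof.
move=> x1; have [phi Hphi] := @nested_series (fun=> 1) (fun=> x) (fun=> x1).
have E m : phi m = phi 0%N.
  have H := @nested_zero (fun=> x) (fun m => phi m.+1 - phi m) (fun=> x1).
  elim: m => [//|m <-]; apply/eqP; rewrite -subr_eq0; apply/eqP; apply: H => k.
  transitivity ((1 + x * phi k.+2) - (1 + x * phi k.+1)); first by rewrite -!Hphi.
  by ring.
exists (phi 0%N); have := Hphi 0%N; rewrite E => e.
by rewrite mulrBr mulr1 {1}e; ring.
Qed.

(** [S c] is the sum of the [c_j x^j]. Its recursion determines it, so later identities are proved
    by peeling off constant terms rather than by limits. *)
Lemma comp_power_series x : cker 1 x ->
  exists S : (nat -> C) -> C, forall c, S c = c 0%N + x * S (fun j => c j.+1).
Proof.
move=> x1; have [phi Hphi] := choice (fun c => @nested_series c (fun=> x) (fun=> x1)).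
exists (fun c => phi c 0%N) => c; rewrite {1}Hphi; congr (_ + _ * _).
apply/eqP; rewrite -subr_eq0; apply/eqP.
apply: (@nested_zero (fun=> x) (fun m => phi c m.+1 - phi (fun j => c j.+1) m)) => // m.
set c' := fun j => c j.+1.
transitivity ((c m.+1 + x * phi c m.+2) - (c' m + x * phi c' m.+1)).
  by rewrite -!Hphi.
by rewrite /c'; ring.
Qed.

End CompletionTheory.

(** * Contraction of ideals to the base ring *)

Section Contraction.
Variable R : comPzRingType.
Hypothesis nR : noeth R.

Definition ideal_sum_exp (I : ideal R) (p : prime_ideal R) M : ideal R :=
  Ideal (add_ideal_ideal (idealP I) (expI_ideal (ideal_of_prime p) M)).

(* The contraction to [R] of the ideal generated by [b] and [I] in [A]. *)
Definition contr_gen (A : ralg R) (b : A) (I : ideal R) : set R :=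
  [set r | exists a, ideal_set (ideal_ext (ralg_map A) I) (ralg_map A r - a * b)].

Lemma loc_ext p (A : ralg R) (I : ideal R) d :
  ideal_set (ideal_ext (ralg_map (localization p A)) I) d ->
  exists s w, [/\ ~ prime_set p s, ideal_set (ideal_ext (ralg_map A) I) w &
    ralg_map (localization p A) s * d = loc_map p A w].
Proof.
set D := localization p A; set J := ideal_ext (ralg_map A) I.
have iJ : is_ideal J := idealP J.
pose K := [set d : D | exists s w, [/\ ~ prime_set p s, ideal_set J w &
  ralg_map D s * d = loc_map p A w]].
suff sub : ideal_ext (ralg_map D) I `<=` K by apply: sub.
apply: ext_min; last first.
  move=> r Ir; exists 1, (ralg_map A r).
  by rewrite rmorph1 mul1r; split=> //; [exact: prime_n1|exact: mem_ext].
split.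
- exists 1, 0; rewrite !rmorph0 mulr0; split=> //; first exact: prime_n1.
  exact: ideal_zero.
- move=> x y [s [v [ns Jv ev]]] [t [w [nt Jw ew]]].
  exists (s * t), (ralg_map A t * v + ralg_map A s * w); split.
  + exact: prime_nM.
  + by apply: ideal_add => //; apply: ideal_mul.
  + rewrite rmorphD !rmorphM -!loc_map_ralg -ev -ew; ring.
- move=> a x [s [v [ns Jv ev]]]; have [t [a' [nt ea]]] := loc_num a.
  exists (t * s), (a' * v); split; [exact: prime_nM|exact: ideal_mul|].
  by rewrite !rmorphM -ev -ea; ring.
Qed.

(** Modulo [p^M] the coefficient [a] may be replaced by an element [c] of the localization; clearing
    denominators costs one factor [s] outside [p]. *)
Lemma contr_gen_step p (A : ralg R) (b : A) (I : ideal R) r :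
  contr_gen (comp_map p (localization p A) (loc_map p A b)) I r ->
  forall M, exists2 s, ~ prime_set p s & contr_gen b (ideal_sum_exp I p M) (s * r).
Proof.
set D := localization p A; move=> [a Ha] M.
set IM := ideal_sum_exp I p M.
have iI := idealP I; have iIM := idealP IM.
pose J := ideal_ext (ralg_map D) IM; have iJ : is_ideal J := idealP J.
(* Up to [cker M], the extension of [I] to the completion comes from the localization. *)
have sub w : ideal_set (ideal_ext (ralg_map (completion p D)) I) w ->
    exists2 d, ideal_set J d & cker M (w - comp_map p D d).
  move=> Hw; pose K := [set w : completion p D |
    exists2 d, ideal_set J d & cker M (w - comp_map p D d)].
  have iK : is_ideal K.
    have ick := @cker_ideal _ p D M.
    split.
    - exists 0; first exact: ideal_zero.
      by rewrite rmorph0 subrr; apply: ideal_zero.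
    - move=> u v [d Jd Hd] [e Je He]; exists (d + e); first exact: ideal_add.
      by rewrite rmorphD opprD addrACA; apply: ideal_add.
    - move=> u v [d Jd Hd]; have [c Hc] := cker_approx M u.
      exists (c * d); first exact: ideal_mul.
      rewrite rmorphM (_ : _ - _ = u * (v - comp_map p D d) +
        (u - comp_map p D c) * comp_map p D d); last by ring.
      by apply: ideal_add => //; [apply: ideal_mul|apply: ideal_mulr].
  apply: (ext_min iK) Hw => x Ix; exists (ralg_map D x).
    by apply: mem_ext; apply: sub_add_ideall => //; apply: expI_ideal.
  by rewrite comp_map_ralg subrr; apply: ideal_zero; apply: cker_ideal.
have [d Jd Hd] := sub _ Ha; have [c Hc] := cker_approx M a.
have Jr : ideal_set J (loc_map p A (ralg_map A r) - c * loc_map p A b).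
  suff : ideal_set J (loc_map p A (ralg_map A r) - c * loc_map p A b - d).
    by move=> H; apply: ideal_eq H Jd.
  suff /cker_map : cker M (comp_map p D (loc_map p A (ralg_map A r) - c * loc_map p A b - d)).
    apply: ideal_ext_subset; apply: sub_add_idealr; exact: idealP.
  have ick := @cker_ideal _ p D M.
  apply: (ideal_eq ick _ Hd); rewrite !rmorphB rmorphM comp_map_ralg loc_map_ralg.
  rewrite (_ : _ - _ = (a - comp_map p D c) * comp_map p D (loc_map p A b)); last by ring.
  exact: ideal_mulr.
have [s [w [ns Jw ew]]] := loc_ext Jr.
have [t [c' [nt ec]]] := loc_num c.
have : loc_map p A (ralg_map A (t * s * r) - ralg_map A s * c' * b - ralg_map A t * w) = 0.
  rewrite !rmorphB !rmorphM -ec -ew -!loc_map_ralg; ring.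
move=> /loc_zeroP[v nv /eqP]; rewrite mulrBr subr_eq0 => /eqP e.
exists (v * (t * s)); first by do 2!apply: prime_nM => //.
exists (ralg_map A v * (ralg_map A s * c')).
rewrite (_ : _ - _ = ralg_map A v * (ralg_map A (t * s * r) - ralg_map A s * c' * b)).
  rewrite e; do 2!(apply: ideal_mul; first exact: idealP).
  exact: Jw.
by rewrite !rmorphM; ring.
Qed.

(** Krull's theorem removes [p^M]. As the hypothesis concerns every [I + p^M], a descent along a
    flag must control a family of ideals closed under such enlargements. *)
Lemma contr_gen_down p (A : ralg R) (b : A) (I : ideal R) :
  (forall M, contr_gen b (ideal_sum_exp I p M) `<=` psat p (ideal_sum_exp I p M)) ->
  contr_gen (comp_map p (localization p A) (loc_map p A b)) I `<=` psat p I.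
Proof.
move=> H r Hr; have iI := idealP I; apply: krull => // M.
have [s ns /H] := contr_gen_step Hr M.
by apply: psatM => //; apply: (idealP (ideal_sum_exp I p M)).
Qed.

(** The construction of [ind_pro_completion] over an arbitrary base, so that a flag can be cut in
    two. *)
Definition completion_chain (l : seq (prime_ideal R)) (A : ralg R) : ralg R :=
  foldr (fun p B => completion p (localization p B)) A l.

Fixpoint is_chain (p : prime_ideal R) (l : seq (prime_ideal R)) : Prop :=
  if l is q :: l' then p `<` q /\ is_chain q l' else True.

(** The descent with [b = 0]. A larger prime allows fewer denominators, so its saturation is
    contained in the one at [p]. *)
Lemma contraction p l : is_chain p l -> forall (I : ideal R) r,
  ideal_set (ideal_ext (ralg_map (completion_chain (p :: l) (@RAlg R R idfun))) I)
    (ralg_map (completion_chain (p :: l) (@RAlg R R idfun)) r) ->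
  psat p I r.
Proof.
move=> cl I r Hr; move: cl.
have {Hr} : contr_gen (comp_map p _ (loc_map p
    (completion_chain l (@RAlg R R idfun)) 0)) I r.
  by exists 0; rewrite mul0r subr0.
elim: l p I r => [|q l IHl] p I r.
  move=> Hr _; apply: (contr_gen_down _ Hr) => M z [a].
  rewrite mulr0 subr0 => Jz; apply: sub_psat.
  suff sub : ideal_ext (ralg_map (@RAlg R R idfun)) (ideal_sum_exp I p M) `<=`
     ideal_sum_exp I p M by apply: sub.
  by apply: ext_min => //; apply: idealP.
move=> Hr [[pq _] cl]; apply: (contr_gen_down _ Hr) => M z [a Hz].
apply: (psat_mono pq); apply: IHl => //.
by exists a; rewrite !rmorph0.
Qed.

End Contraction.

(** * Unsaturated flags *)

(** The last clause is what is kept of finite dimension: descending chains of ideals become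
    stationary on [V m]. The unit [s] is there because the [V m] will be images of polynomials,
    which exhaust [R] only up to denominators. *)
Definition finite_filtration (R : comPzRingType) (V : nat -> set R) : Prop :=
  [/\ forall m n, (m <= n)%N -> V m `<=` V n,
      forall r, exists m s u, u * s = 1 /\ V m (s * r) &
      forall m (K : nat -> set R), (forall n, is_ideal (K n)) ->
        (forall n, K n.+1 `<=` K n) ->
        exists N, forall v, V m v -> K N v -> forall M, K M v].

Section Lacunary.
Variables (R : comPzRingType) (nR : noeth R) (p0 q p : prime_ideal R) (x y : R).
Hypotheses (p0q : p0 `<=` q) (qp : q `<=` p).
Hypotheses (qx : prime_set q x) (np0x : ~ prime_set p0 x).
Hypotheses (py : prime_set p y) (nqy : ~ prime_set q y).

Let p0p : p0 `<=` p. Proof. by move=> z /p0q /qp. Qed.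
Let i0 : is_ideal p0 := prime_is_ideal p0.
Let ip : is_ideal p := prime_is_ideal p.
Let np0y : ~ prime_set p0 y. Proof. by move=> /p0q. Qed.

(* [K j] is the contraction to [R] of the ideal [y^j] of the localization at [p]
   of [R / p0]. *)
Let K j := psat p (add_gen p0 (y ^+ j)).
Let iK j : is_ideal (K j).
Proof. by apply: psat_ideal; apply: add_gen_ideal. Qed.

Let K_p0 j z : prime_set p0 z -> K j z.
Proof. by move=> p0z; apply: sub_psat; apply: sub_add_gen. Qed.

Let K_y j k z : K k z -> K (j + k) (y ^+ j * z).
Proof.
move=> [s ns [a Ha]]; exists s => //; exists a.
rewrite (_ : _ - _ = y ^+ j * (s * z - a * y ^+ k)); last by rewrite exprD; ring.
exact: ideal_mul.
Qed.

Let K_mono j k : (j <= k)%N -> K k `<=` K j.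
Proof.
move=> jk; apply: psatS => z [a Ha]; exists (a * y ^+ (k - j)).
by rewrite -mulrA -exprD subnK.
Qed.

Let cancel_p0 s z : ~ prime_set p0 s -> prime_set p0 (s * z) -> prime_set p0 z.
Proof. by move=> ns /primeM[]. Qed.

Let prime_expr_gt0 n : (0 < n)%N -> prime_set p (y ^+ n).
Proof. by case: n => // n _; rewrite exprS; apply: ideal_mulr. Qed.

(** An Artin-Rees bound in the localization of [R / p0] at [p]: division by [X] loses at most [e] in
    [y]-adic order. *)
Definition delays (X : R) (e : nat) := forall r j, K j (X * r) -> K (j - e) r.
(** [X] stays a non-unit when [y] is inverted in the localization of [R / p0] at [p]. *)
Definition no_power (X : R) := forall n, ~ psat p (add_gen p0 X) (y ^+ n).

(** If [x r = y^j t], then [y^e t] is already a multiple of [x] for an [e] independent of [j];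
    cancelling [x] in the domain [R / p0] makes [r] a multiple of [y^(j-e)]. *)
Lemma delays_start : exists e, delays x e.
Proof.
have iX : is_ideal (psat p (add_gen p0 x)) by apply: psat_ideal; apply: add_gen_ideal.
have [e He] := colon_stable nR y iX; exists e => r j [s ns [t Ht]].
have [je|ej] := leqP j e.
  rewrite (_ : j - e = 0)%N; last by lia.
  by apply: sub_psat; exists r; rewrite expr0 mulr1 subrr; apply: ideal_zero.
have [s' ns' [t' Ht']] : psat p (add_gen p0 x) (y ^+ e * t).
  apply: (He j); apply: sub_psat; exists (s * r).
  rewrite (_ : _ - _ = - (s * (x * r) - t * y ^+ j)); last by ring.
  exact: ideal_opp.
exists (s' * s); first exact: prime_nM.
exists t'; apply: (cancel_p0 np0x).
rewrite (_ : _ * _ = s' * (s * (x * r) - t * y ^+ j) +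
   y ^+ (j - e) * (s' * (y ^+ e * t) - t' * x)).
  by apply: ideal_add => //; apply: ideal_mul.
have -> : y ^+ j = y ^+ (j - e) * y ^+ e by rewrite -exprD subnK // ltnW.
by ring.
Qed.

Lemma no_power_start : no_power x.
Proof.
move=> n [s ns [a Ha]]; apply: (prime_nM (x := s) (y := y ^+ n) (p := q)).
- by move=> /qp.
- exact: prime_nX.
have iq := prime_is_ideal q.
by rewrite -(subrK (a * x) (s * y ^+ n)); apply: ideal_add => //; [exact: p0q|exact: ideal_mul].
Qed.

(** The bound for [X] at order [M] gives [r = y^(M-e) r1], and [r1] satisfies the hypothesis at the
    order [j - (M-e)], which is lower because [e < M]. *)
Lemma delays_step X e M : (e < M)%N -> delays X e -> delays (X - y ^+ M) e.
Proof.
move=> eM dX r j; elim/ltn_ind: j r => j IHj r Hj.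
have KM k : (k <= M)%N -> (k <= j)%N -> K k (X * r).
  move=> kM kj; rewrite (_ : _ * _ = (X - y ^+ M) * r + y ^+ M * r); last by ring.
  apply: ideal_add => //; first exact: K_mono Hj.
  apply: (K_mono kM); rewrite -[M in K M]addn0; apply: K_y.
  by apply: sub_psat; exists r; rewrite expr0 mulr1 subrr; apply: ideal_zero.
have [jM|Mj] := leqP j M; first by apply: dX; apply: KM.
have [s ns [r1 Hr1]] := dX _ _ (KM M (leqnn _) (ltnW Mj)).
have [s' ns' [g Hg]] := Hj.
have Kr1 : K (j - (M - e)) ((X - y ^+ M) * (s' * r1)).
  apply: sub_psat; exists (s * g); apply: (cancel_p0 (prime_nX (n := (M - e)%N) np0y)).
  rewrite (_ : _ * _ = s * (s' * ((X - y ^+ M) * r) - g * y ^+ j) -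
    s' * (X - y ^+ M) * (s * r - r1 * y ^+ (M - e))).
    by apply: ideal_sub => //; apply: ideal_mul.
  have -> : y ^+ j = y ^+ (M - e) * y ^+ (j - (M - e)).
    by rewrite -exprD subnKC //; lia.
  by ring.
have {Kr1} Kr1 : K (j - M) r1.
  have -> : (j - M = (j - (M - e)) - e)%N by lia.
  apply: (psatM (s := s') (add_gen_ideal _ i0) ns').
  by apply: IHj Kr1; lia.
apply: (psatM (s := s) (add_gen_ideal _ i0) ns).
rewrite -(subrK (r1 * y ^+ (M - e)) (s * r)).
apply: (ideal_add (iK _)); first exact: K_p0.
rewrite mulrC (_ : j - e = (M - e) + (j - M))%N; last by lia.
exact: K_y.
Qed.

(** If [y^n = a (X - y^M)], the bound gives [a y^e = a' y^n], whence [a' X = y^e (1 + y^(M-e) a')];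
    the last factor is a unit at [p], as [e < M]. *)
Lemma no_power_step X e M : (e < M)%N -> delays X e -> no_power X ->
  no_power (X - y ^+ M).
Proof.
move=> eM dX nX n [s ns [a Ha]].
have [s' ns' [a' Ha']] : K n (a * y ^+ e).
  rewrite -[n](addnK e); apply: (delays_step eM dX); apply: sub_psat; exists s.
  rewrite (_ : _ - _ = - (y ^+ e * (s * y ^+ n - a * (X - y ^+ M)))).
    by apply: ideal_opp => //; apply: ideal_mul.
  by rewrite exprD; ring.
apply: (nX e); exists (s * s' + y ^+ (M - e) * a').
  by apply: prime_add; [exact: prime_nM|apply: (ideal_mulr ip); apply: prime_expr_gt0; rewrite subn_gt0].
exists a'; apply: (cancel_p0 (prime_nX (n := n) np0y)).
rewrite (_ : _ * _ = s' * y ^+ e * (s * y ^+ n - a * (X - y ^+ M)) +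
  (X - y ^+ M) * (s' * (a * y ^+ e) - a' * y ^+ n)).
  by apply: ideal_add => //; apply: ideal_mul.
have -> : y ^+ M = y ^+ (M - e) * y ^+ e by rewrite -exprD subnK // ltnW.
by ring.
Qed.

Lemma no_power_notin X : no_power X -> forall s n a, ~ prime_set p s ->
  ~ prime_set p0 (s * y ^+ n - a * X).
Proof. by move=> nX s n a ns H; apply: (nX n); exists s => //; exists a. Qed.

(* Up to factors [s y^n] with [s] outside [p], each [b_k] divides [g] modulo [I] and
   is comaximal with the later [b_j], so [g] is successively divisible by b_0, b_1,
   ..., with quotients [h_k].  A linear relation expressing some [h_(N+1)] through
   its predecessors then puts [(s y^n - a b_N) h_(N+1)] in [I]. *)
Lemma coprime_descent (I : set R) (b : nat -> R) (M : nat -> nat) g :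
  is_ideal I -> psat p0 I `<=` I ->
  (forall k, b k.+1 = b k - y ^+ M k) -> (forall k, (M k < M k.+1)%N) ->
  (forall k, no_power (b k)) ->
  (forall k, psat p (add_gen I (b k)) g) -> I g.
Proof.
move=> iI satI bS MS nb Hg.
have incr k j : (k < j)%N -> (M k < M j)%N.
  elim: j => [//|j IHj]; rewrite ltnS leq_eqVlt => /orP[/eqP ->//|/IHj] lt.
  exact: ltn_trans lt (MS j).
(* The difference is [y^(M k)] times a unit at [p]: this is the comaximality of [b k] and [b j] once
   [y] is inverted. *)
have bkj k j : (k < j)%N -> exists2 w, ~ prime_set p w & b k - b j = y ^+ M k * w.
  elim: j => [//|j IHj]; rewrite ltnS leq_eqVlt => /orP[/eqP ->|kj].
    by exists 1; [exact: prime_n1|rewrite bS; ring].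
  have [w nw e] := IHj kj; exists (w + y ^+ (M j - M k)).
    by apply: prime_add => //; apply: prime_expr_gt0; rewrite ?subn_gt0 ?incr.
  by rewrite mulrDr -exprD subnKC ?(ltnW (incr _ _ kj)) // -e bS; ring.
have cancelI s n z : ~ prime_set p s -> I (s * y ^+ n * z) -> I z.
  move=> ns Iz; apply: satI; exists (s * y ^+ n) => //.
  by apply: prime_nM; [move=> /p0p|exact: prime_nX].
pose Q (k : nat) (z : R) := forall j, (k <= j)%N -> exists (s : R) (n : nat),
  ~ prime_set p s /\ add_gen I (b j) (s * y ^+ n * z).
have step kg : exists g', Q kg.1 kg.2 -> Q kg.1.+1 g' /\ exists s n,
    ~ prime_set p s /\ I (s * y ^+ n * kg.2 - g' * b kg.1).
  case: kg => k h /=; have [Qk|] := pselect (Q k h); last by exists 0.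
  have [s [n [ns [g' Hg']]]] := Qk k (leqnn k).
  exists g' => _; split; last by exists s, n.
  move=> j kj; have [s' [n' [ns' [r Hr]]]] := Qk j (ltnW kj).
  have [w nw ew] := bkj _ _ kj.
  exists (s' * w), (n' + M k)%N; split; first exact: prime_nM.
  exists (s * y ^+ n * r - s' * y ^+ n' * g').
  rewrite (_ : _ - _ = s * y ^+ n * (s' * y ^+ n' * h - r * b j) -
    s' * y ^+ n' * (s * y ^+ n * h - g' * b k)).
    by apply: ideal_sub => //; apply: ideal_mul.
  rewrite exprD (_ : _ * _ * g' = s' * y ^+ n' * (y ^+ M k * w) * g'); last by ring.
  by rewrite -ew; ring.
have [G HG] := choice step.
pose h := fix h k := if k is k'.+1 then G (k', h k') else g.
have Qh k : Q k (h k).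
  elim: k => [|k IHk]; last by have [] := HG (k, h k) IHk.
  move=> j _; have [s ns Hs] := Hg j; exists s, 0%N; split=> //.
  by rewrite expr0 mulr1.
have hS k : exists s n, ~ prime_set p s /\ I (s * y ^+ n * h k - h k.+1 * b k).
  by have [] := HG (k, h k) (Qh k).
have h0 : h 0%N = g by [].
move: h h0 hS {Qh HG} => h h0 hS.
have [N [a eN]] := noeth_seq nR h.
case: N eN => [|N] eN; first by rewrite -h0 eN big_ord0; apply: ideal_zero.
(* Up to such a factor, [h k] is [b_k ... b_N h_(N+1)] modulo [I]. *)
have chain d k : (k + d = N)%N -> exists s n z, ~ prime_set p s /\ I (s * y ^+ n * h k - z * b N * h N.+1).
  elim: d k => [|d IHd] k e.
    rewrite -e addn0; have [s [n [ns H]]] := hS k; exists s, n, 1; split=> //.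
    by rewrite mul1r [b _ * _]mulrC.
  have [s [n [ns H]]] := hS k; have [|s' [n' [z [ns' H']]]] := IHd k.+1; first by lia.
  exists (s * s'), (n + n')%N, (z * b k); split; first exact: prime_nM.
  rewrite (_ : _ - _ = s' * y ^+ n' * (s * y ^+ n * h k - h k.+1 * b k) +
    b k * (s' * y ^+ n' * h k.+1 - z * b N * h N.+1)); last by rewrite exprD; ring.
  by apply: ideal_add => //; apply: ideal_mul.
have part n : (n <= N.+1)%N -> exists s e z, ~ prime_set p s /\ I (s * y ^+ e * (\sum_(k < n) a k * h k) - z * b N * h N.+1).
  elim: n => [|n IHn] nN.
    exists 1, 0%N, 0; split; first exact: prime_n1.
    by rewrite big_ord0 mulr0 !mul0r subrr; apply: ideal_zero.
  have [s [e [z [ns H]]]] := IHn (ltnW nN).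
  have [s' [e' [z' [ns' H']]]] := chain (N - n)%N n (subnKC (nN : (n <= N)%N)).
  exists (s * s'), (e + e')%N, (s' * y ^+ e' * z + s * y ^+ e * a n * z').
  split; first exact: prime_nM.
  rewrite big_ord_recr [X in _ * X - _]/= (_ : _ - _ =
    s' * y ^+ e' * (s * y ^+ e * (\sum_(k < n) a k * h k) - z * b N * h N.+1) +
    s * y ^+ e * a n * (s' * y ^+ e' * h n - z' * b N * h N.+1)); last first.
    by rewrite exprD; ring.
  by apply: ideal_add => //; apply: ideal_mul.
have [s [e [z [ns]]]] := part N.+1 (leqnn _); rewrite -eN -mulrBl => H.
have {H} IhN : I (h N.+1).
  by apply: satI; eexists; last exact: H; apply: no_power_notin.
have [s' [e' [z' [ns' H']]]] := chain N 0%N (add0n N).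
apply: (cancelI s' e') => //; rewrite -h0.
by apply: (ideal_eq iI H'); apply: ideal_mul.
Qed.

End Lacunary.

Section LacunarySeries.
Variables (R : comPzRingType) (nR : noeth R) (V : nat -> set R).
Hypothesis Vfin : finite_filtration V.
Variables (p0 q p : prime_ideal R) (x y : R).
Hypotheses (p0q : p0 `<=` q) (qp : q `<=` p).
Hypotheses (qx : prime_set q x) (np0x : ~ prime_set p0 x).
Hypotheses (py : prime_set p y) (nqy : ~ prime_set q y).

Definition partial_lacunary (E : nat -> nat) (c m : nat) : R :=
  x - y ^+ c * \sum_(i < m) y ^+ E i.

(** [E m] is chosen after the earlier exponents, beyond finitely many stability bounds, those with
    [c, j <= m]; every pair [(c, j)] is thus covered from some [m] on. *)
Lemma lacunary_exponents (J : nat -> ideal R) e : exists E : nat -> nat,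
  [/\ forall m, (e < E m)%N, forall m, (E m < E m.+1)%N &
    forall m c j v, (c <= m)%N -> (j <= m)%N -> V m v ->
      psat p (add_gen (add_gen (J j) (partial_lacunary E c m)) (y ^+ E m)) v ->
      psat p (add_gen (J j) (partial_lacunary E c m)) v].
Proof.
have [_ _ Vst] := Vfin.
(* On [V m] the ideals become stationary as the power of [y] grows, so lying in one of them means
   lying in all, and Krull's theorem applies. *)
have ex (mbj : nat * R * nat) : exists N, forall v, V mbj.1.1 v ->
    psat p (add_gen (add_gen (J mbj.2) mbj.1.2) (y ^+ N)) v ->
    psat p (add_gen (J mbj.2) mbj.1.2) v.
  case: mbj => [[m b] j] /=; have iJ := idealP (J j).
  have iJb : is_ideal (add_gen (J j) b) by apply: add_gen_ideal.
  have [||N HN] := Vst m (fun N => psat p (add_gen (add_gen (J j) b) (y ^+ N))).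
  - by move=> n; apply: psat_ideal; apply: add_gen_ideal.
  - move=> n; apply: psatS => z [a Ha]; exists (a * y).
    by rewrite -mulrA -exprS.
  exists N => v Vv Kv; apply: (krull_principal nR iJb py).
  exact: HN.
have [N HN] := choice ex.
pose b c (s : seq nat) := x - y ^+ c * \sum_(i < size s) y ^+ nth 0%N s i.
(* The summands push [E m] above [e], above all earlier exponents and above the stability bounds. *)
pose Phi s := (e + sumn s + \sum_(c < (size s).+1) \sum_(j < (size s).+1)
  N (size s, b c s, nat_of_ord j)).+1.
have [E HE] := course_of_values Phi.
have bE c m : b c (mkseq E m) = partial_lacunary E c m.
  rewrite /b /partial_lacunary size_mkseq; congr (_ - _ * _).
  by apply: eq_bigr => i _; rewrite nth_mkseq.
exists E; split.
- by move=> m; rewrite HE /Phi; lia.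
- move=> m; rewrite (HE m.+1) /Phi mkseqS.
  by rewrite -cats1 sumn_cat /=; lia.
- move=> m c j v cm jm Vv Hv; have := HN (m, partial_lacunary E c m, j) v Vv; apply.
  have le : (N (m, partial_lacunary E c m, j) <= E m)%N.
    rewrite HE /Phi size_mkseq.
    rewrite (bigD1 (Ordinal (cm : (c < m.+1)%N))) //= (bigD1 (Ordinal (jm : (j < m.+1)%N))) //=.
    by rewrite bE; lia.
  apply: psatS Hv => z [a Ha]; exists (a * y ^+ (E m - N (m, partial_lacunary E c m, j))).
  by rewrite -mulrA -exprD subnK.
Qed.

Lemma lacunary_family (D : ralg R) (J : nat -> ideal R) :
  (forall (I : ideal R) r, ideal_set (ideal_ext (ralg_map (completion p D)) I)
     (ralg_map (completion p D) r) -> psat p I r) ->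
  exists b : nat -> completion p D,
    (forall c c', (c < c')%N -> exists n u v, v * u = 1 /\
       b c - b c' = ralg_map (completion p D) (y ^+ n) * u) /\
    (forall c j, contr_gen (b c) (J j) `<=` psat p0 (J j)).
Proof.
set A := completion p D => contr.
have np0y : ~ prime_set p0 y by move=> /p0q.
have p0p : p0 `<=` p by move=> z /p0q /qp.
(* Saturating at [p0] provides the hypothesis [psat p0 I <= I] of [coprime_descent]. *)
pose J' j := Ideal (psat_ideal p0 (idealP (J j))).
have [e de] := delays_start nR p y np0x.
have [E [eE incE VE]] := lacunary_exponents J' e.
have homoE i j : (i < j)%N -> (E i < E j)%N.
  by apply: (homo_ltn ltn_trans).
pose Y : A := ralg_map A y.
have Y1 : cker 1 Y.
  by rewrite /Y comp_map_ralg; apply/cker_map; apply: mem_ext; apply/expI1.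
have YX1 n : (0 < n)%N -> cker 1 (Y ^+ n).
  by case: n => // n _; rewrite exprS; apply: ideal_mulr => //; apply: cker_ideal.
(* [phi m] is the tail [sum_(j >= m) y^(E j - E m)]. *)
have [phi Hphi] : exists phi : nat -> A, forall m,
    phi m = 1 + Y ^+ (E m.+1 - E m) * phi m.+1.
  by apply: (nested_series (fun=> 1)) => m; apply: YX1; rewrite subn_gt0.
pose f := Y ^+ E 0%N * phi 0%N.
have fE m : f = \sum_(i < m) Y ^+ E i + Y ^+ E m * phi m.
  elim: m => [|m IHm]; first by rewrite big_ord0 add0r.
  rewrite IHm big_ord_recr /= {1}Hphi mulrDr mulr1 mulrA -exprD.
  by rewrite subnKC ?addrA // ltnW.
exists (fun c => ralg_map A x - Y ^+ c * f); split.
  move=> c c' cc'.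
  have [u eu] : exists u, u * phi 0%N = 1.
    have [|u eu] := @cker1_unit _ p D (- (Y ^+ (E 1%N - E 0%N) * phi 1%N)).
      apply: ideal_opp; first exact: cker_ideal.
      by apply: ideal_mulr; [exact: cker_ideal|apply: YX1; rewrite subn_gt0].
    by exists u; rewrite Hphi -{2}eu opprK.
  have [v ev] : exists v, v * (1 - Y ^+ (c' - c)) = 1.
    by apply: cker1_unit; apply: YX1; rewrite subn_gt0.
  (* [b c - b c'] is [-(y^c - y^c') f], where [f] is [y^(E 0)] times the unit [phi 0] and
     [y^c - y^c'] is [y^c] times a unit. *)
  exists (c + E 0%N)%N, (- (phi 0%N * (1 - Y ^+ (c' - c)))), (- (u * v)).
  split.
    transitivity ((u * phi 0%N) * (v * (1 - Y ^+ (c' - c)))); first by ring.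
    by rewrite eu ev mulr1.
  rewrite rmorphXn -/Y /f exprD.
  have -> : Y ^+ c' = Y ^+ c * Y ^+ (c' - c) by rewrite -exprD subnKC // ltnW.
  by ring.
move=> c j r [a Ha].
(* Truncating [f] changes [b c] by a multiple of [y^(E m)], and the truncation comes from [R], so
   the relation can be contracted. *)
have Jr m : psat p (add_gen (add_gen (J' j) (partial_lacunary E c m)) (y ^+ E m)) r.
  pose I : ideal R := Ideal (add_gen_ideal (y ^+ E m)
     (add_gen_ideal (partial_lacunary E c m) (idealP (J' j)))).
  apply: (contr I); have iI := idealP I.
  pose X := ideal_ext (ralg_map A) I; have iX : is_ideal X := idealP X.
  have JI : ideal_ext (ralg_map A) (J j) `<=` X.
    apply: ideal_ext_subset => z Jz; apply: sub_add_gen; apply: sub_add_gen.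
    exact: sub_psat.
  apply: (ideal_eq iX (JI _ Ha)).
  rewrite (fE m) (_ : _ * _ = a * ralg_map A (partial_lacunary E c m) -
    a * Y ^+ c * phi m * ralg_map A (y ^+ E m)); last first.
    have -> : ralg_map A (partial_lacunary E c m) =
        ralg_map A x - Y ^+ c * \sum_(i < m) Y ^+ E i.
      rewrite rmorphB rmorphM rmorphXn rmorph_sum; congr (_ - _ * _).
      by apply: eq_bigr => i _; rewrite rmorphXn.
    by rewrite rmorphXn -/Y; ring.
  apply: ideal_sub => //; apply: ideal_mul => //; apply: mem_ext.
    apply: sub_add_gen; rewrite -[X in add_gen _ _ X]mul1r; apply: add_gen_gen.
    exact: (idealP (J' j)).
  rewrite -[X in ideal_set _ X]mul1r; apply: add_gen_gen.
  exact: (add_gen_ideal _ (idealP (J' j))).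
have [Vmono Vall _] := Vfin.
have [m0 [s [u [us Vsr]]]] := Vall r.
(* [m0] puts a unit multiple of [r] in the filtration; [c] and [j] meet the conditions under which
   [E] was chosen. *)
pose m1 := maxn m0 (maxn c j).
have pe m : delays p0 p y (partial_lacunary E c m) e /\
    no_power p0 p y (partial_lacunary E c m).
  elim: m => [|m [dm nm]].
    rewrite /partial_lacunary big_ord0 mulr0 subr0; split=> //.
    exact: (no_power_start p0q qp qx nqy).
  have -> : partial_lacunary E c m.+1 = partial_lacunary E c m - y ^+ (c + E m).
    by rewrite /partial_lacunary big_ord_recr /= exprD; ring.
  have lt : (e < c + E m)%N by rewrite ltn_addl.
  split; first exact: (delays_step p0q nqy lt).
  exact: (no_power_step p0q py nqy lt).
have iJ' := idealP (J' j).
apply: (@coprime_descent _ nR p0 q p y p0q qp py nqy (J' j)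
  (fun k => partial_lacunary E c (m1 + k)) (fun k => c + E (m1 + k))%N) => //.
- by apply: psat_id; apply: idealP.
- by move=> k; rewrite addnS /partial_lacunary big_ord_recr /= exprD; ring.
- by move=> k; rewrite addnS ltn_add2l.
- by move=> k; case: (pe (m1 + k)%N).
- move=> k; have iX := psat_ideal p (add_gen_ideal (partial_lacunary E c (m1 + k)) iJ').
  rewrite -[r]mul1r -us -mulrA; apply: ideal_mul => //.
  apply: VE; [by rewrite /m1; lia|by rewrite /m1; lia| |].
    by apply: Vmono Vsr; rewrite /m1; lia.
  apply: ideal_mul; last exact: Jr.
  by apply: psat_ideal; do 2!apply: add_gen_ideal.
Qed.

End LacunarySeries.

(** * Descent along the lower part of an unsaturated flag *)

Section NonSemilocal.
Variables (R : comPzRingType) (nR : noeth R) (V : nat -> set R).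
Hypothesis Vfin : finite_filtration V.

Definition separated_family (A : ralg R) (y : R) (b : nat -> A) :=
  forall c c', (c < c')%N -> exists n u v, v * u = 1 /\
    b c - b c' = ralg_map A (y ^+ n) * u.

(** [rcons l pi] is the lower part of the flag, so its head is the smallest prime. The closure of
    [Fam] is what [contr_gen_down] demands at each level. *)
Lemma chain_down (pi : prime_ideal R) (y : R) (Fam : ideal R -> Prop) l
    (A : ralg R) (b : nat -> A) :
  (forall j I M, (j <= size l)%N -> Fam I ->
     Fam (ideal_sum_exp I (nth pi (rcons l pi) j) M)) ->
  is_chain (head pi (rcons l pi)) (behead (rcons l pi)) ->
  separated_family y b ->
  (forall c I, Fam I -> contr_gen (b c) I `<=` psat pi I) ->
  exists b' : nat -> completion_chain (rcons l pi) A,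
    separated_family y b' /\
    (forall c I, Fam I -> contr_gen (b' c) I `<=` psat (head pi (rcons l pi)) I).
Proof.
have up (p : prime_ideal R) (B : ralg R) (b1 : nat -> B) : separated_family y b1 ->
    separated_family y (fun c => comp_map p _ (loc_map p B (b1 c))).
  move=> sep c c' /sep[n [u [v [uv e]]]].
  exists n, (comp_map p _ (loc_map p B u)), (comp_map p _ (loc_map p B v)).
  by rewrite -!rmorphM -!rmorphB uv e !rmorph1 !rmorphM.
elim: l => [|p l IHl] FamC /= cl sepb mb.
  exists (fun c => comp_map pi _ (loc_map pi A (b c))); split; first exact: up.
  move=> c I FI; apply: contr_gen_down => // M; apply: mb.
  exact: (FamC 0%N).
have [] := IHl _ _ sepb mb.
- by move=> j I M jl; apply: (FamC j.+1).
- by case: (l) cl => [//|p' l'] /= [].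
move=> b' [sep' mb'].
exists (fun c => comp_map p _ (loc_map p _ (b' c))); split; first exact: up.
have sub : p `<=` head pi (rcons l pi) by case: (l) cl => [|p' l'] /= [[]].
move=> c I FI; apply: contr_gen_down => // M z Hz; apply: (psat_mono sub).
by apply: mb' Hz; apply: (FamC 0%N).
Qed.

Lemma chain_head_sub (pi : prime_ideal R) l :
  is_chain (head pi (rcons l pi)) (behead (rcons l pi)) ->
  head pi (rcons l pi) `<=` pi.
Proof.
elim: l => [_ z //|p l IHl] /= cl z pz; apply: IHl.
  by case: (l) cl => [//|p' l'] /= [].
by case: (l) cl => [|p' l'] /= [[sub _] _]; apply: sub.
Qed.

Lemma chain_unit (pi : prime_ideal R) l (A : ralg R) s :
  ~ prime_set (head pi (rcons l pi)) s ->
  exists u, u * ralg_map (completion_chain (rcons l pi) A) s = 1.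
Proof.
have unit1 (p : prime_ideal R) (B : ralg R) : ~ prime_set p s ->
    exists u, u * ralg_map (completion p (localization p B)) s = 1.
  move=> ns; have [u eu] := loc_unit B ns; exists (comp_map p _ u).
  by rewrite comp_map_ralg -rmorphM eu rmorph1.
by case: l => [|p l] /=; apply: unit1.
Qed.

Lemma not_semilocal (l l2 : seq (prime_ideal R)) (pi q p : prime_ideal R) :
  is_chain (head pi (rcons l pi)) (behead (rcons l pi)) ->
  is_chain p l2 -> pi `<` q -> q `<` p ->
  ~ semilocal (completion_chain (rcons l pi)
        (completion_chain (p :: l2) (@RAlg R R idfun))).
Proof.
set A := completion_chain (p :: l2) _ => cl cl2 [piq nqpi] [qp npq].
have [x qx npix] : exists2 x, prime_set q x & ~ prime_set pi x.
  by apply: contrapT => H; apply: nqpi => x qx; apply: contrapT => nx; apply: H; exists x.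
have [y py nqy] : exists2 y, prime_set p y & ~ prime_set q y.
  by apply: contrapT => H; apply: npq => y py; apply: contrapT => ny; apply: H; exists y.
set p0 := head pi (rcons l pi) in cl *.
(* The ideals met during the descent are coded by lists of pairs (position of a prime, exponent);
   [pickle] enumerates them for a single lacunary series. *)
pose fam (s : seq (nat * nat)) : ideal R := foldr (fun jM I =>
  ideal_sum_exp I (nth pi (rcons l pi) jM.1) jM.2) (ideal_of_prime p0) s.
pose J k := fam (odflt [::] (unpickle k)).
have [b [sepb mb]] := @lacunary_family _ nR V Vfin pi q p x y piq qp qx npix py nqy
  (localization p (completion_chain l2 (@RAlg R R idfun))) J (contraction nR cl2).
have [] := @chain_down pi y (fun I => exists s, I = fam s) l A b _ cl sepb.
- by move=> j I M _ [s ->]; exists ((j, M) :: s).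
- move=> c I [s ->]; have -> : fam s = J (pickle s) by rewrite /J pickleK.
  exact: mb.
move=> b' [sep' mb'].
set T := completion_chain _ A in b' sep' mb' *.
(* If [b' c] were a unit, [1] would lie in the contraction for [I = p0], hence in [p0]. *)
have nb c u : u * b' c <> 1.
  move=> e; apply: (@prime_n1 _ p0); apply: psat_prime.
  apply: (mb' c (fam [::])); first by exists [::].
  by exists u; rewrite e rmorph1 subrr; apply: ideal_zero; apply: idealP.
have exm c : exists m : set T, is_maximal_ideal m /\ m (b' c).
  by have [m] := maximal_containing (nb c); exists m.
have [m Hm] := choice exm.
have np0y : ~ prime_set p0 y.
  by move=> p0y; apply: nqy; apply: piq; apply: chain_head_sub p0y.
have unitT s : ~ prime_set p0 s -> exists u, u * ralg_map T s = 1.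
  exact: chain_unit.
have neq c c' : (c < c')%N -> m c <> m c'.
  move=> cc' e; have [[im mT _] mc] := Hm c; have [_ mc'] := Hm c'.
  have [n [u [v [vu ebb]]]] := sep' _ _ cc'.
  have [w ew] := unitT (y ^+ n) (prime_nX np0y).
  apply: mT; apply: ideal_setT => //.
  rewrite (_ : 1 = w * v * (b' c - b' c')).
    by apply: ideal_mul => //; apply: ideal_sub => //; rewrite e.
  by rewrite ebb -[LHS]mulr1 -[X in X * _]ew -vu; ring.
move=> fin; apply: infinite_nat.
have : finite_set (m @^-1` [set m : set T | is_maximal_ideal m]).
  apply: finite_preimage => // c c' _ _ e; apply/eqP; case: ltngtP => // /neq; first by [].
  by rewrite e.
apply: sub_finite_set => c _ /=; by have [] := Hm c.
Qed.

End NonSemilocal.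

(** * Saturated flags *)

(* In the zero ring, the whole ring counts as a subfield. *)
Record is_subfield (A : comPzRingType) (F : set A) : Prop := IsSubfield {
  subfield1 : F 1;
  subfieldB : forall x y, F x -> F y -> F (x - y);
  subfieldM : forall x y, F x -> F y -> F (x * y);
  subfieldV : forall x, F x -> x <> 0 -> exists2 y, F y & y * x = 1 }.

(** Carries [1 != 0] so that [subfield_type] is a [fieldType] and matrix rank applies. *)
Record nz_subfield (A : comPzRingType) := NzSubfield {
  nz_subfield_set : set A;
  nz_subfieldP : is_subfield nz_subfield_set;
  nz_subfield_nz : (1 : A) != 0 }.

Section SubfieldType.
Variables (A : comPzRingType) (F : nz_subfield A).

Definition subfield_pred : {pred A} := fun x => `[< nz_subfield_set F x >].

Lemma subfield_pred_closed : subring_closed subfield_pred.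
Proof.
have [F1 FB FM _] := nz_subfieldP F.
split; first exact/asboolP.
- by move=> x y /asboolP Fx /asboolP Fy; apply/asboolP; apply: FB.
- by move=> x y /asboolP Fx /asboolP Fy; apply/asboolP; apply: FM.
Qed.

HB.instance Definition _ := GRing.isSubringClosed.Build A subfield_pred
  subfield_pred_closed.

Definition subfield_type : Type := {x | x \in subfield_pred}.
HB.instance Definition _ := SubChoice.on subfield_type.
HB.instance Definition _ := GRing.SubChoice_isSubComPzRing.Build
  A subfield_pred subfield_type subfield_pred_closed.

Lemma subfield_type_nz : (1 : subfield_type) != 0.
Proof.
by apply: contraNneq (nz_subfield_nz F) => /(congr1 val) /= e; apply/eqP.
Qed.

HB.instance Definition _ := GRing.PzSemiRing_isNonZero.Build subfield_type
  subfield_type_nz.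

Lemma subfield_inv_ex (x : subfield_type) : exists y : subfield_type,
  (x != 0 -> y * x = 1) /\ (x = 0 -> y = 0).
Proof.
have [-> |x0] := eqVneq x 0; first by exists 0.
have [_ _ _ FV] := nz_subfieldP F.
have [|y Fy e] := FV _ (asboolP _ (valP x)).
  by move=> v0; case/eqP: x0; apply: val_inj.
exists (exist _ y (asboolT Fy)); split=> [_|e0]; first exact: val_inj.
by case/eqP: x0.
Qed.

Definition subfield_inv x : subfield_type := projT1 (cid (subfield_inv_ex x)).

Lemma subfield_mulV (x : subfield_type) : x != 0 -> subfield_inv x * x = 1.
Proof. by rewrite /subfield_inv; case: cid => y /= []. Qed.
Lemma subfield_inv0 : subfield_inv 0 = 0.
Proof. by rewrite /subfield_inv; case: cid => y /= [_ ->]. Qed.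

HB.instance Definition _ := GRing.ComNzRing_isField.Build subfield_type
  subfield_mulV subfield_inv0.

Lemma subfield_lindep w (C : 'I_w.+1 -> 'I_w -> A) :
  (forall j i, nz_subfield_set F (C j i)) ->
  exists u : 'I_w.+1 -> A, [/\ forall j, nz_subfield_set F (u j),
    exists j, u j <> 0 & forall i, \sum_j u j * C j i = 0].
Proof.
move=> FC; pose M : 'M[subfield_type]_(w.+1, w) :=
  \matrix_(j, i) exist _ (C j i) (asboolT (FC j i)).
have : kermx M != 0.
  rewrite -mxrank_eq0 mxrank_ker -lt0n subn_gt0 ltnS; exact: rank_leq_col.
move=> /rowV0Pn[v /sub_kermxP vM v0].
exists (fun j => val (v 0 j)); split.
- by move=> j; apply/asboolP; apply: (valP (v 0 j)).
- have [j vj] : exists j, v 0 j != 0.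
    by apply/existsP; apply: contraNT v0 => /existsPn H; apply/eqP/rowP => j;
       rewrite mxE; apply/eqP; rewrite -[_ == _]negbK H.
  by exists j => e; case/eqP: vj; apply: val_inj.
- move=> i; transitivity (val ((v *m M) 0 i)); last by rewrite vM mxE.
  rewrite mxE (big_morph (val : subfield_type -> A) (id1 := 0) (op1 := +%R)) //.
  by apply: eq_bigr => j _; rewrite mxE.
Qed.

End SubfieldType.

Section Spans.
Variables (A : comPzRingType) (F : set A) (J : set A).
Hypotheses (sF : is_subfield F) (iJ : is_ideal J).

Lemma subfield0 : F 0.
Proof. by rewrite -(subrr 1); case: sF => F1 FB _ _; apply: FB. Qed.
Lemma subfieldN x : F x -> F (- x).
Proof. by rewrite -sub0r => Fx; case: sF => _ FB _ _; apply: FB => //; apply: subfield0. Qed.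
Lemma subfieldD x y : F x -> F y -> F (x + y).
Proof.
by move=> Fx Fy; rewrite -[y]opprK; case: sF => _ FB _ _; apply: FB => //; apply: subfieldN.
Qed.
(** The [F]-span of [r] modulo [J]. Indexing by a [finType] lets families be combined through sums
    and products of index types. *)
Definition spans (T : finType) (r : T -> A) : set A :=
  [set a | exists c : T -> A, (forall i, F (c i)) /\ J (a - \sum_i c i * r i)].

Definition finite_over := exists (T : finType) (r : T -> A), forall a, spans r a.

Variables (T : finType) (r : T -> A).

Lemma spans_ideal x : J x -> spans r x.
Proof.
move=> Jx; exists (fun=> 0); split=> [_|]; first exact: subfield0.
by rewrite big1 ?subr0 // => i _; rewrite mul0r.
Qed.

Lemma spansD x y : spans r x -> spans r y -> spans r (x + y).
Proof.
move=> [c [Fc Jc]] [d [Fd Jd]]; exists (fun i => c i + d i).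
split=> [i|]; first exact: subfieldD.
under eq_bigr do rewrite mulrDl.
by rewrite big_split opprD addrACA; apply: ideal_add.
Qed.

Lemma spansZ a x : F a -> spans r x -> spans r (a * x).
Proof.
move=> Fa [c [Fc Jc]]; exists (fun i => a * c i).
split=> [i|]; first by case: sF => _ _ FM _; apply: FM.
under eq_bigr do rewrite -mulrA.
by rewrite -mulr_sumr -mulrBr; apply: ideal_mul.
Qed.

Lemma spans_sum (I : Type) (s : seq I) (P : pred I) G :
  (forall i, P i -> spans r (G i)) -> spans r (\sum_(i <- s | P i) G i).
Proof.
move=> H; apply: big_ind => //; last exact: spansD.
by apply: spans_ideal; apply: ideal_zero.
Qed.

Lemma spans_gen i : spans r (r i).
Proof.
exists (fun j => (j == i)%:R); split=> [j|].
  by case: eqP => _; [case: sF|exact: subfield0].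
rewrite (bigD1 i) //= eqxx mul1r big1 ?addr0 ?subrr; first exact: ideal_zero.
by move=> j /negPf ->; rewrite mul0r.
Qed.

Lemma spans_mod x y : J (x - y) -> spans r y -> spans r x.
Proof. by move=> Jxy My; rewrite -(subrK y x); apply: spansD => //; apply: spans_ideal. Qed.

Lemma spansM : (forall i j, spans r (r i * r j)) ->
  forall x y, spans r x -> spans r y -> spans r (x * y).
Proof.
move=> rr x y [c [Fc Jc]] [d [Fd Jd]].
apply: (@spans_mod _ ((\sum_i c i * r i) * (\sum_j d j * r j))).
  rewrite (_ : _ - _ = (x - \sum_i c i * r i) * y +
    (\sum_i c i * r i) * (y - \sum_j d j * r j)); last by ring.
  by apply: ideal_add => //; [apply: ideal_mulr|apply: ideal_mul].
rewrite mulr_suml; apply: spans_sum => i _; rewrite mulr_sumr; apply: spans_sum => j _.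
rewrite (_ : _ * _ = c i * (d j * (r i * r j))); last by ring.
by do 2!apply: spansZ => //.
Qed.

Lemma spans_lindep (v : nat -> A) : (1 : A) != 0 -> (forall j, spans r (v j)) ->
  exists u : nat -> A, [/\ forall j, F (u j), exists2 j, (j <= #|T|)%N & u j <> 0 &
    J (\sum_(j < #|T|.+1) u j * v j)].
Proof.
move=> nz Mv; have [c Hc] := choice Mv.
have [|u [Fu [j0 uj0] u0]] := @subfield_lindep A (NzSubfield sF nz) #|T|
   (fun j i => c j (enum_val i)); first by move=> j i; case: (Hc j) => Fc _; apply: Fc.
pose u' j := u (inord j); exists u'; split; first by move=> j; apply: Fu.
  by exists j0; [rewrite -ltnS|rewrite /u' inord_val].
have -> : \sum_(j < #|T|.+1) u' j * v j =
    \sum_(j < #|T|.+1) u j * (v j - \sum_i c j i * r i).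
  rewrite [RHS](_ : _ = \sum_(j < #|T|.+1) u j * v j -
     \sum_(j < #|T|.+1) u j * \sum_i c j i * r i); last first.
    by rewrite -sumrB; apply: eq_bigr => j _; rewrite mulrBr.
  rewrite [X in _ - X](_ : _ = 0) ?subr0.
    by apply: eq_bigr => j _; rewrite /u' inord_val.
  under eq_bigr do rewrite mulr_sumr.
  rewrite exchange_big /= big1 // => i _.
  have /= := u0 (enum_rank i); under eq_bigr do rewrite enum_rankK.
  by move=> e; under eq_bigr do rewrite mulrA; rewrite -mulr_suml e mul0r.
by apply: ideal_sum => // j _; apply: ideal_mul => //; case: (Hc j).
Qed.

(* A relation between the powers of [s], divided by its lowest term, expresses
   the inverse of [s] as a polynomial in [s]. *)
Lemma spans_inv s t : (forall x y, spans r x -> spans r y -> spans r (x * y)) ->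
  spans r 1 -> spans r s -> t * s = 1 -> spans r t.
Proof.
move=> MM M1 Ms ts.
have [z1|nz] := eqVneq (1 : A) 0.
  by rewrite -[t]mulr1 z1 mulr0; apply: spans_ideal; apply: ideal_zero.
have MX j : spans r (s ^+ j).
  by elim: j => [//|j IHj]; rewrite exprS; apply: MM.
have [u [Fu [j0 j0w uj0] Ju]] := spans_lindep nz MX.
move: j0w Ju; rewrite -ltnS; move: #|T|.+1 => w.
elim: w u j0 uj0 Fu => [//|w IHw] u j0 uj0 Fu.
have eS : \sum_(j < w) u j.+1 * s ^+ j.+1 = s * \sum_(j < w) u j.+1 * s ^+ j.
  by rewrite mulr_sumr; apply: eq_bigr => j _; rewrite exprS; ring.
rewrite big_ord_recl /= expr0 mulr1 eS => j0w Ju.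
have [u00|/eqP u0] := eqVneq (u 0%N) 0.
  case: j0 j0w uj0 => [_|j0 j0w uj0]; first by rewrite u00.
  apply: (IHw (fun j => u j.+1) j0) => //.
  rewrite -[X in J X]mul1r -ts -mulrA; apply: ideal_mul => //.
  by move: Ju; rewrite u00 add0r.
case: sF => _ _ _ /(_ _ (Fu 0%N) u0)[y Fy yu].
apply: (@spans_mod _ (- y * \sum_(j < w) u j.+1 * s ^+ j)).
  rewrite (_ : _ - _ = y * t * (u 0%N + s * \sum_(j < w) u j.+1 * s ^+ j)).
    exact: ideal_mul.
  set S := \sum_(j < w) _.
  transitivity (t * 1 + y * S * 1); first by ring.
  by rewrite -{1}yu -ts; ring.
apply: spansZ; first exact: subfieldN.
by apply: spans_sum => j _; apply: spansZ.
Qed.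

End Spans.

(** Serves twice: for power series once [x] is inverted, and for polynomials in an element
    transcendental modulo [J]. *)
Lemma fraction_subfield (D : comPzRingType) (S : set D) :
  S 1 -> (forall x y, S x -> S y -> S (x - y)) ->
  (forall x y, S x -> S y -> S (x * y)) ->
  (forall x, S x -> x <> 0 -> exists u, u * x = 1) ->
  is_subfield [set z | exists a b u, [/\ S a, S b, u * b = 1 & z = a * u]].
Proof.
move=> S1 SB SM SV; split.
- by exists 1, 1, 1; rewrite mulr1.
- move=> _ _ [a [b [u [Sa Sb ub ->]]]] [a' [b' [u' [Sa' Sb' ub' ->]]]].
  exists (a * b' - a' * b), (b * b'), (u * u'); split; [|exact: SM| |].
  + by apply: SB; apply: SM.
  + by rewrite mulrACA ub ub' mulr1.
  + transitivity (a * u * (u' * b') - a' * u' * (u * b)); last by ring.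
    by rewrite ub ub' !mulr1.
- move=> _ _ [a [b [u [Sa Sb ub ->]]]] [a' [b' [u' [Sa' Sb' ub' ->]]]].
  exists (a * a'), (b * b'), (u * u'); split; [exact: SM|exact: SM| |].
  + by rewrite mulrACA ub ub' mulr1.
  + by ring.
- move=> _ [a [b [u [Sa Sb ub ->]]]] nz.
  have [|v va] := SV a Sa; first by move=> a0; apply: nz; rewrite a0 mul0r.
  exists (b * v); first by exists b, a, v.
  by transitivity ((v * a) * (u * b)); [ring|rewrite va ub mulr1].
Qed.

(** * Finiteness modulo a prime, completion and semilocality *)

Section FiniteCompletion.
Variables (R : comPzRingType) (nR : noeth R).
Implicit Types (p : prime_ideal R) (A D : ralg R) (I : ideal R).

Definition ext A I : set A := ideal_ext (ralg_map A) I.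

Lemma extP A I : is_ideal (@ext A I).
Proof. exact: idealP. Qed.

Lemma ext_gen A I w (g : 'I_w -> R) :
  (forall x, ideal_set I x -> exists c : 'I_w -> R, x = \sum_i c i * g i) ->
  forall z, @ext A I z -> exists h : 'I_w -> A, z = \sum_i ralg_map A (g i) * h i.
Proof.
move=> gen z; pose K := [set z | exists h : 'I_w -> A,
  z = \sum_i ralg_map A (g i) * h i].
suff sub : @ext A I `<=` K by apply: sub.
apply: ext_min; last first.
  move=> x /gen[c ->]; exists (fun i => ralg_map A (c i)); rewrite rmorph_sum.
  by apply: eq_bigr => i _; rewrite rmorphM mulrC.
split.
- by exists (fun=> 0); rewrite big1 // => i _; rewrite mulr0.
- move=> _ _ [h ->] [h' ->]; exists (fun i => h i + h' i).
  by rewrite -big_split; apply: eq_bigr => i _; rewrite mulrDr.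
- move=> a _ [h ->]; exists (fun i => a * h i); rewrite mulr_sumr.
  by apply: eq_bigr => i _; rewrite mulrCA.
Qed.

Lemma ext_genM A I w (g : 'I_w -> R) l :
  (forall x, ideal_set I x -> exists c : 'I_w -> R, x = \sum_i c i * g i) ->
  forall z, ext (ideal_exp I l.+1) z -> exists h : 'I_w -> A,
    (forall i, ext (ideal_exp I l) (h i)) /\ z = \sum_i ralg_map A (g i) * h i.
Proof.
move=> gen z; pose K := [set z | exists h : 'I_w -> A,
    (forall i, ext (ideal_exp I l) (h i)) /\ z = \sum_i ralg_map A (g i) * h i].
have iE := @extP A (ideal_exp I l).
have iK : is_ideal K.
  split.
  - exists (fun=> 0); split=> [_|]; first exact: ideal_zero.
    by rewrite big1 // => i _; rewrite mulr0.
  - move=> _ _ [h [Eh ->]] [h' [Eh' ->]]; exists (fun i => h i + h' i).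
    split=> [i|]; first exact: ideal_add.
    by rewrite -big_split; apply: eq_bigr => i _; rewrite mulrDr.
  - move=> a _ [h [Eh ->]]; exists (fun i => a * h i).
    split=> [i|]; first exact: ideal_mul.
    by rewrite mulr_sumr; apply: eq_bigr => i _; rewrite mulrCA.
suff sub : @ext A (ideal_exp I l.+1) `<=` K by apply: sub.
apply: (ext_min iK) => x Ix.
pose K' := [set x | K (ralg_map A x)].
have iK' : is_ideal K'.
  split; rewrite /K' /mkset; first by rewrite rmorph0; apply: ideal_zero.
  - by move=> u v; rewrite rmorphD; apply: ideal_add.
  - by move=> a u; rewrite rmorphM; apply: ideal_mul.
suff sub : expI I l.+1 `<=` K' by apply: sub.
apply: expIS_min => // u v /gen[c ->] Iv; exists (fun i => ralg_map A (c i * v)).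
split=> [i|]; first by apply: mem_ext; apply: ideal_mul => //; apply: expI_ideal.
rewrite mulr_suml rmorph_sum; apply: eq_bigr => i _.
by rewrite -rmorphM; congr (ralg_map A _); ring.
Qed.

(** Relies on [p] being finitely generated: successive corrections are written on its generators
    with coefficients in [p^l], and each coefficient is summed separately to a limit [H i]. *)
Lemma cker1_ext p D (a : completion p D) : cker 1 a -> ext (ideal_of_prime p) a.
Proof.
move=> a1; have [w [g [gp gen]]] := nR (prime_is_ideal p).
have [d Hd] := choice (fun l => cker_approx l a).
have ick l := @cker_ideal _ p D l.
have [h0 e0] : exists h : 'I_w -> D, d 1%N = \sum_i ralg_map D (g i) * h i.
  apply: (ext_gen (I := ideal_of_prime p) gen).
  suff : cker 1 (comp_map p D (d 1%N)).
    by move/cker_map; apply: ideal_ext_subset => x /expI1.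
  by rewrite -[comp_map _ _ _](subKr a); apply: ideal_sub.
have ex l : exists h : 'I_w -> D, (forall i, ext (ideal_exp (ideal_of_prime p) l) (h i)) /\
    d l.+2 - d l.+1 = \sum_i ralg_map D (g i) * h i.
  apply: (ext_genM (I := ideal_of_prime p) gen); apply/cker_map.
  rewrite rmorphB (_ : _ - _ = (a - comp_map p D (d l.+1)) - (a - comp_map p D (d l.+2))).
    by apply: ideal_sub => //; apply: cker_decr (Hd l.+2).
  by ring.
have [h Hh] := choice ex.
pose s l i := h0 i + \sum_(j < l) h j i.
have exH i : exists H : completion p D, forall l, cker l (H - comp_map p D (s l i)).
  apply: cker_cauchy => l; case: (Hh l) => El _.
  rewrite /s big_ord_recr /= (_ : _ - _ = h l i); last by ring.
  exact: El.
have [H HH] := choice exH.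
have es l : \sum_i ralg_map D (g i) * s l i = d l.+1.
  elim: l => [|l IHl].
    by rewrite e0; apply: eq_bigr => i _; rewrite /s big_ord0 addr0.
  case: (Hh l) => _ e; rewrite -[d l.+2](subrK (d l.+1)) e -IHl -big_split; apply: eq_bigr => i _.
  by rewrite /s big_ord_recr /=; ring.
have -> : a = \sum_i ralg_map (completion p D) (g i) * H i.
  apply/eqP; rewrite -subr_eq0; apply/eqP/cker_sep => l.
  rewrite (_ : _ - _ = (a - comp_map p D (d l.+1)) -
     \sum_i ralg_map (completion p D) (g i) * (H i - comp_map p D (s l i))).
    apply: ideal_sub => //; first exact: cker_decr (Hd l.+1).
    by apply: ideal_sum => // i _; apply: ideal_mul.
  under [in RHS]eq_bigr do rewrite mulrBr.
  rewrite sumrB -es rmorph_sum.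
  under [X in _ - X - _]eq_bigr do rewrite rmorphM -comp_map_ralg.
  by ring.
apply: ideal_sum; first exact: extP.
move=> i _; apply: ideal_mulr; first exact: extP.
by apply: mem_ext; apply: gp.
Qed.

Lemma finite_completion p D (F : set D) : is_subfield F ->
  finite_over F (ext (ideal_of_prime p)) ->
  exists F' : set (completion p D), is_subfield F' /\
    finite_over F' (ext (ideal_of_prime p)).
Proof.
move=> [F1 FB FM FV] [T [r Mr]]; exists (comp_map p D @` F); split.
  split.
  - by exists 1 => //; rewrite rmorph1.
  - by move=> _ _ [x Fx <-] [y Fy <-]; exists (x - y); [exact: FB|rewrite rmorphB].
  - by move=> _ _ [x Fx <-] [y Fy <-]; exists (x * y); [exact: FM|rewrite rmorphM].
  - move=> _ [x Fx <-] nz; have [|y Fy yx] := FV x Fx.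
      by move=> x0; apply: nz; rewrite x0 rmorph0.
    by exists (comp_map p D y); [exists y|rewrite -rmorphM yx rmorph1].
exists T, (comp_map p D \o r) => a.
have [d Hd] := cker_approx 1 a; have [c [Fc Jc]] := Mr d.
exists (comp_map p D \o c); split=> [i|]; first by exists (c i).
apply: cker1_ext; have ick := @cker_ideal _ p D 1.
have es : comp_map p D (\sum_i c i * r i) =
    \sum_i (comp_map p D \o c) i * (comp_map p D \o r) i.
  by rewrite rmorph_sum; apply: eq_bigr => i _; rewrite rmorphM.
apply: (ideal_eq ick (y := comp_map p D (d - \sum_i c i * r i))).
  by rewrite rmorphB es opprB addrA subrK.
by apply/cker_map; apply: (ideal_ext_subset _ Jc) => x px; apply/expI1.
Qed.

(** Among infinitely many maximal ideals, take [w] one more than the size of the spanning family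
    and, for [j < w], [v j] in all [m i] with [i < w] except [m j]. The extension of [p] lies in
    every [m j], so a dependence modulo it puts some [v j] in [m j]. *)
Lemma finite_semilocal p D (F : set (completion p D)) : is_subfield F ->
  finite_over F (ext (ideal_of_prime p)) -> semilocal (completion p D).
Proof.
move=> sF [T [r Mr]]; set A := completion p D in F sF r Mr *.
have iJ := @extP A (ideal_of_prime p).
have rad (m : set A) : is_maximal_ideal m -> ext (ideal_of_prime p) `<=` m.
  case=> im mT mmax x Jx; apply: contrapT => nx.
  have [e|e] := mmax _ (add_gen_ideal x im) (@sub_add_gen _ m x).
    by apply: nx; rewrite -e -[x in add_gen _ _ x]mul1r; apply: add_gen_gen.
  have [a Ha] : add_gen m x 1 by rewrite e.
  have [|u eu] := @cker1_unit _ p D (a * x).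
    apply: cker_ext; rewrite -[X in ideal_set X](_ : ideal_ext (ralg_map A) (ideal_exp (ideal_of_prime p) 1) = _) //.
    apply: ideal_mul; first exact: idealP.
    by apply: (ideal_ext_subset _ Jx) => z pz; apply/expI1.
  by apply: mT; apply: ideal_setT => //; rewrite -eu; apply: ideal_mul.
apply: contrapT => /infiniteP/pcard_leP/injfunPex[m mm minj].
have maxm j : is_maximal_ideal (m j) by apply: mm.
have primem j : is_prime_ideal (m j) by apply: maximal_prime.
have im j : is_ideal (m j) by case: (maxm j).
have nz : (1 : A) != 0.
  apply/eqP => e; case: (maxm 0%N) => _ mT _; apply: mT; apply: ideal_setT => //.
  by rewrite e; apply: ideal_zero.
have sepm i j : exists z, i <> j -> m i z /\ ~ m j z.
  have [->|ij] := pselect (i = j); first by exists 0.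
  have [z [iz jz]] : exists z, m i z /\ ~ m j z; last by exists z.
  apply: contrapT => none; apply: ij; apply: minj; rewrite ?inE //.
  have [_ mjT _] := maxm j; have [_ _ mimax] := maxm i.
  have [//|->//|//] := mimax (m j) (im j).
  by move=> z iz; apply: contrapT => jz; apply: none; exists z.
have [z Hz] := choice (fun ij : nat * nat => sepm ij.1 ij.2).
pose w := #|T|.+1.
pose v j := \prod_(i < w | i != j :> nat) z (nat_of_ord i, j).
have vin i j : (i < w)%N -> i <> j -> m i (v j).
  move=> iw ij; rewrite /v (bigD1 (Ordinal iw)) /=; last exact/eqP.
  by apply: ideal_mulr => //; case: (Hz (i, j) ij).
have vout j : ~ m j (v j).
  rewrite /v; apply: (big_ind (fun x => ~ m j x)).
  - by case: (primem j) => _ mT _ m1; apply: mT; apply: ideal_setT.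
  - by case: (primem j) => _ _ mP x y nx ny /mP[].
  - by move=> i /eqP ij; case: (Hz (nat_of_ord i, j) ij).
have [u [Fu [j jw uj] Ju]] := spans_lindep sF iJ nz (fun j => Mr (v j)).
have mu := rad _ (maxm j) _ Ju.
rewrite (bigD1 (Ordinal (jw : (j < w)%N))) //= in mu.
case: sF => _ _ _ /(_ _ (Fu j) uj)[t _ tu].
apply: (vout j); rewrite -[v j]mul1r -tu -mulrA; apply: ideal_mul => //.
rewrite -(addrK (\sum_(i < w | i != Ordinal (jw : (j < w)%N)) u i * v i) (u j * v j)).
apply: ideal_sub => //; apply: ideal_sum => // i /eqP ij.
apply: ideal_mul => //; apply: vin => // e; apply: ij; exact: val_inj.
Qed.

End FiniteCompletion.

(** * Power series with coefficients in a completion *)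

Section PowerSeries.
Variables (R : comPzRingType) (p : prime_ideal R) (D : ralg R).
Local Notation A := (completion p D).
Variables (x : A) (S : (nat -> A) -> A).
Hypotheses (x1 : cker 1 x) (SE : forall c, S c = c 0%N + x * S (fun j => c j.+1)).

(** Coinduction on series: an identity holds once its discrepancy [delta] is [x] times the
    discrepancy for the shifted data [next z]. *)
Lemma series_coind (X : Type) (next : X -> X) (delta : X -> A) :
  (forall z, delta z = x * delta (next z)) -> forall z, delta z = 0.
Proof.
move=> dE z; apply: (@nested_zero _ p D (fun=> x) (fun m => delta (iter m next z))
   (fun=> x1) _ 0%N) => m.
by rewrite dE iterS.
Qed.

Lemma series0 : S (fun=> 0) = 0.
Proof.
apply: (@series_coind unit id (fun=> S (fun=> 0)) _ tt) => _.
by rewrite {1}SE add0r.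
Qed.

Lemma seriesB c d : S (fun j => c j - d j) = S c - S d.
Proof.
apply/eqP; rewrite -subr_eq0; apply/eqP.
pose delta (cd : (nat -> A) * (nat -> A)) :=
  S (fun j => cd.1 j - cd.2 j) - (S cd.1 - S cd.2).
pose next (cd : (nat -> A) * (nat -> A)) :=
  (fun j => cd.1 j.+1, fun j => cd.2 j.+1).
apply: (@series_coind _ next delta _ (c, d)) => -[a b]; rewrite /delta /next /=.
by rewrite (SE (fun j => a j - b j)) (SE a) (SE b); ring.
Qed.

Lemma seriesZ a c : S (fun j => a * c j) = a * S c.
Proof.
apply/eqP; rewrite -subr_eq0; apply/eqP.
apply: (@series_coind _ (fun c j => c j.+1)
  (fun c => S (fun j => a * c j) - a * S c)) => b.
by rewrite (SE (fun j => a * b j)) (SE b); ring.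
Qed.

Lemma seriesD c d : S (fun j => c j + d j) = S c + S d.
Proof.
have -> : (fun j => c j + d j) = (fun j => c j - -1 * d j).
  by apply: funext => j; ring.
by rewrite seriesB seriesZ; ring.
Qed.

(** The coefficients [sum_(i <= k) c_i d_(k-i)], computed by shifting [c] only, so that one
    unfolding of [S] matches the recursion. *)
Fixpoint cauchy_prod (c d : nat -> A) k : A :=
  if k is k'.+1 then c 0%N * d k + cauchy_prod (fun j => c j.+1) d k'
  else c 0%N * d 0%N.

Lemma seriesM c d : S (cauchy_prod c d) = S c * S d.
Proof.
apply/eqP; rewrite -subr_eq0; apply/eqP.
apply: (@series_coind _ (fun c j => c j.+1)
  (fun c => S (cauchy_prod c d) - S c * S d)) => b.
rewrite (SE (cauchy_prod b d)) /= seriesD seriesZ (SE b).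
transitivity (b 0%N * (d 0%N + x * S (fun j => d j.+1)) +
  x * S (cauchy_prod (fun j => b j.+1) d) -
  (b 0%N + x * S (fun j => b j.+1)) * S d); first by ring.
by rewrite -SE; ring.
Qed.

Lemma series_unit0 (F : set A) c : is_subfield F -> (forall j, F (c j)) ->
  c 0%N <> 0 -> exists v, v * S c = 1.
Proof.
move=> sF Fc c0; have [b Fb bc] := subfieldV sF (Fc 0%N) c0.
have [|u eu] := @cker1_unit _ p D (- (x * (b * S (fun j => c j.+1)))).
  by apply: ideal_opp; [|apply: ideal_mulr => //]; apply: cker_ideal.
exists (u * b); rewrite SE -eu.
transitivity (u * (b * c 0%N + x * (b * S (fun j => c j.+1)))); first by ring.
by rewrite bc; ring.
Qed.

(** Factoring out the lowest power of [x] leaves a unit; hence inverting [x] makes every nonzero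
    series over [F] invertible. *)
Lemma series_unit (F : set A) c : is_subfield F -> (forall j, F (c j)) -> S c <> 0 ->
  exists n v, v * S c = x ^+ n.
Proof.
move=> sF Fc nz.
have [m cm] : exists m, c m <> 0.
  apply: contrapT => none; apply: nz; rewrite -[RHS]series0; congr S.
  by apply: funext => j; apply: contrapT => cj; apply: none; exists j.
elim: m c Fc cm {nz} => [|m IHm] c Fc cm; last have [c0|] := pselect (c 0%N = 0).
- by exists 0%N; apply: series_unit0 sF Fc cm.
- have [n [v e]] := IHm (fun j => c j.+1) (fun j => Fc j.+1) cm.
  by exists n.+1, v; rewrite SE c0 add0r exprS -e; ring.
- by exists 0%N; apply: series_unit0 sF Fc _.
Qed.

End PowerSeries.

Section FiniteStep.
Variables (R : comPzRingType) (nR : noeth R).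
Implicit Types (p : prime_ideal R) (A D : ralg R) (I : ideal R).

(** From [N] to [N + 1]: coefficients on the generators [g k] of [I] matter only modulo [I^N], so
    [r] together with the products [g k * r' i] spans. *)
Lemma finite_exp A I (F : set A) N : is_subfield F -> finite_over F (ext I) ->
  finite_over F (ext (ideal_exp I N)).
Proof.
move=> sF [T [r Mr]]; have [w [g [gI gen]]] := nR (idealP I).
elim: N => [|N [T' [r' Mr']]].
  exists void, (of_void _) => a; apply: spans_ideal => //.
  rewrite -[a]mulr1 -(rmorph1 (ralg_map A)); apply: ideal_mul; first exact: extP.
  by apply: mem_ext; apply: expI0.
have iE : is_ideal (@ext _ A (ideal_exp I N.+1)) by apply: extP.
pose r2 (i : T + 'I_w * T') := match i with
  inl i => r i | inr (k, i) => ralg_map A (g k) * r' i end.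
exists (T + 'I_w * T')%type, r2 => a.
have [c [Fc Jc]] := Mr a; have [h eh] := ext_gen gen Jc.
rewrite -(subrK (\sum_i c i * r i) a); apply: (spansD sF iE); last first.
  apply: (spans_sum sF iE) => i _; apply: (spansZ sF iE) => //.
  exact: (spans_gen sF iE r2 (inl i)).
rewrite eh; apply: (spans_sum sF iE) => k _; have [d [Fd Jd]] := Mr' (h k).
apply: (spans_mod sF iE (y := \sum_i ralg_map A (g k) * (d i * r' i))).
  rewrite -mulr_sumr -mulrBr.
  pose K := [set z | ext (ideal_exp I N.+1) (ralg_map A (g k) * z)].
  suff sub : @ext _ A (ideal_exp I N) `<=` K by apply: sub.
  apply: ext_min; first split; rewrite /K /mkset.
  - by rewrite mulr0; apply: ideal_zero.
  - by move=> u v; rewrite mulrDr; apply: ideal_add.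
  - by move=> u v; rewrite mulrCA; apply: ideal_mul.
  - by move=> z Iz; rewrite -rmorphM; apply: mem_ext; apply: expIS.
apply: (spans_sum sF iE) => i _; rewrite mulrCA; apply: (spansZ sF iE) => //.
exact: (spans_gen sF iE r2 (inr (k, i))).
Qed.

Lemma finite_step (p' p : prime_ideal R) B
    (F : set (completion p (localization p B))) :
  is_subfield F -> finite_over F (ext (ideal_of_prime p)) -> p' `<` p ->
  (~ exists q : prime_ideal R, p' `<` q /\ q `<` p) ->
  exists F' : set (localization p' (completion p (localization p B))),
    is_subfield F' /\ finite_over F' (ext (ideal_of_prime p')).
Proof.
set A := completion p _ in F *; set D := localization p' A.
move=> sF fF pp' sat.
have [x0 px0 np'x0] : exists2 x, prime_set p x & ~ prime_set p' x.
  by apply: contrapT => H; case: pp' => _; apply => z pz; apply: contrapT => nz; apply: H; exists z.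
pose x : A := ralg_map A x0.
have x1 : cker 1 x by rewrite /x comp_map_ralg; apply/cker_map; apply: mem_ext; apply/expI1.
have [S SE] := comp_power_series x1.
have iE := @extP _ A (ideal_of_prime p').
have [N HN] := saturated_pow nR pp' sat px0 np'x0.
have [T [r Mr]] := finite_exp N sF fF.
have [w [g [gp' gen]]] := nR (prime_is_ideal p').
have unitA s : ~ prime_set p s -> exists u, u * ralg_map A s = 1.
  move=> ns; have [u eu] := loc_unit B ns; exists (comp_map p _ u).
  by rewrite comp_map_ralg -rmorphM eu rmorph1.
have pow : @ext _ A (ideal_exp (ideal_of_prime p) N) `<=` add_gen (ext (ideal_of_prime p')) x.
  apply: ext_min; first exact: add_gen_ideal.
  move=> z /HN[s ns [a Ha]]; have [u eu] := unitA s ns.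
  exists (u * ralg_map A a); rewrite -[ralg_map A z]mul1r -eu.
  rewrite (_ : _ - _ = u * ralg_map A (s * z - a * x0)).
    by apply: ideal_mul => //; apply: mem_ext.
  by rewrite rmorphB !rmorphM /x; ring.
(* Division by [x]: coefficients in [F] on [r], a part in the extension of [p'], and a quotient
   [chn.2] on which the division is repeated. *)
have dec a : exists chn : (T -> A) * ('I_w -> A) * A, (forall i, F (chn.1.1 i)) /\
    a = \sum_i chn.1.1 i * r i + \sum_k ralg_map A (g k) * chn.1.2 k + x * chn.2.
  have [c [Fc /pow[b Eb]]] := Mr a.
  have [h eh] := ext_gen (I := ideal_of_prime p') gen Eb.
  by exists (c, h, b); split=> //=; rewrite -eh; ring.
have [dc Hdc] := choice dec.
pose nxt a := (dc a).2.
pose cs a i j := (dc (iter j nxt a)).1.1 i.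
pose hs a k j := (dc (iter j nxt a)).1.2 k.
(* The coefficients [cs] lie in [F] but the [hs] are arbitrary, which is why [S] accepts every
   sequence in [A]. *)
have aE a : a = \sum_i S (cs a i) * r i + \sum_k ralg_map A (g k) * S (hs a k).
  apply/eqP; rewrite -subr_eq0; apply/eqP.
  apply: (@series_coind _ p _ x x1 A nxt (fun a => a - (\sum_i S (cs a i) * r i +
    \sum_k ralg_map A (g k) * S (hs a k)))) => b.
  have -> : \sum_i S (cs b i) * r i =
      \sum_i (dc b).1.1 i * r i + x * \sum_i S (cs (nxt b) i) * r i.
    rewrite mulr_sumr -big_split; apply: eq_bigr => i _ /=; rewrite SE.
    rewrite (_ : (fun j => cs b i j.+1) = cs (nxt b) i); first by rewrite /cs /=; ring.
    by apply: funext => j; rewrite /cs iterSr.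
  have -> : \sum_k ralg_map A (g k) * S (hs b k) =
      \sum_k ralg_map A (g k) * (dc b).1.2 k + x * \sum_k ralg_map A (g k) * S (hs (nxt b) k).
    rewrite mulr_sumr -big_split; apply: eq_bigr => k _ /=; rewrite SE.
    rewrite (_ : (fun j => hs b k j.+1) = hs (nxt b) k); first by rewrite /hs /=; ring.
    by apply: funext => j; rewrite /hs iterSr.
  by case: (Hdc b) => _ {1}->; rewrite /nxt; ring.
pose ser : set A := [set z | exists c, (forall j, F (c j)) /\ z = S c].
(* The image of [F[[x]]]: a nonzero element divides a power of [x], a unit here since [x0] is
   outside [p']. *)
pose Sd : set D := loc_map p' A @` ser.
have F0 := subfield0 sF.
have Sd1 : Sd 1.
  exists 1; last by rewrite rmorph1.
  exists (fun j => if j is 0%N then 1 else 0).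
  split=> [[|j]|] //=; first by case: sF.
  by rewrite SE /= (series0 x1 SE); ring.
have SdB y z : Sd y -> Sd z -> Sd (y - z).
  move=> [_ [c [Fc ->]] <-] [_ [d [Fd ->]] <-].
  exists (S (fun j => c j - d j)); last by rewrite -rmorphB (seriesB x1 SE).
  by exists (fun j => c j - d j); split=> // j; case: sF => _ FB _ _; apply: FB.
have SdM y z : Sd y -> Sd z -> Sd (y * z).
  move=> [_ [c [Fc ->]] <-] [_ [d [Fd ->]] <-].
  exists (S (cauchy_prod c d)); last by rewrite -rmorphM (seriesM x1 SE).
  exists (cauchy_prod c d); split=> // j; case: (sF) => _ _ FM _.
  elim: j c Fc => [|j IHj] c Fc /=; first exact: FM.
  by apply: (subfieldD sF); [exact: FM|exact: IHj].
have SdV y : Sd y -> y <> 0 -> exists u, u * y = 1.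
  move=> [_ [c [Fc ->]] <-] nz.
  have [|n [v ev]] := series_unit x1 SE sF Fc.
    by move=> e; apply: nz; rewrite e rmorph0.
  have [u eu] := loc_unit A (prime_nX (n := n) np'x0).
  by exists (u * loc_map p' A v); rewrite -mulrA -rmorphM ev -eu loc_map_ralg rmorphXn.
have sF' := fraction_subfield Sd1 SdB SdM SdV.
set F' := [set z | _] in sF'.
have SdF' y : Sd y -> F' y by move=> Sy; exists y, 1, 1; rewrite !mulr1.
exists F'; split=> //; exists T, (loc_map p' A \o r).
have iD := @extP _ D (ideal_of_prime p').
pose M := spans F' (@ext _ D (ideal_of_prime p')) (loc_map p' A \o r).
have MA a : M (loc_map p' A a).
  exists (fun i => loc_map p' A (S (cs a i))); split=> [i|].
    apply: SdF'; exists (S (cs a i)) => //; exists (cs a i); split=> // j.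
    by case: (Hdc (iter j nxt a)) => Fc _; apply: Fc.
  rewrite {1}[a]aE rmorphD !rmorph_sum.
  rewrite (_ : _ - _ = \sum_k loc_map p' A (ralg_map A (g k) * S (hs a k))).
    apply: ideal_sum => // k _; rewrite rmorphM -loc_map_ralg.
    by apply: ideal_mulr => //; apply: mem_ext; apply: gp'.
  under [X in X + _ - _]eq_bigr do rewrite rmorphM.
  by rewrite addrC addKr.
have MM : forall y z, M y -> M z -> M (y * z).
  by apply: (spansM sF' iD) => i j; rewrite /= -rmorphM; apply: MA.
(* The span is closed under products and contains the denominator, so [spans_inv] supplies its
   inverse. *)
move=> d; have [s [a [ns e]]] := loc_num d.
have [u eu] := loc_unit A ns.
rewrite -[d]mul1r -eu -mulrA e; apply: (MM); last exact: MA.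
apply: (spans_inv sF' iD MM _ _ eu); last by rewrite loc_map_ralg; apply: MA.
by rewrite -(rmorph1 (loc_map p' A)); apply: MA.
Qed.

End FiniteStep.

(** * Algebraic elements and maximal subfields *)

Section PolynomialValues.
Variables (D : comPzRingType) (F J : set D) (t : D).
Hypotheses (sF : is_subfield F) (iJ : is_ideal J).

Definition poly_value (s : seq D) : D := foldr (fun c a => c + t * a) 0 s.

Definition in_field (s : seq D) := forall i, (i < size s)%N -> F s`_i.

Lemma in_field_cons c s : in_field (c :: s) <-> F c /\ in_field s.
Proof.
split=> [H|[Fc Fs] [|i]] //; last exact: Fs.
by split=> [|i lt]; [exact: (H 0%N)|exact: (H i.+1)].
Qed.

Definition poly_values : set D := [set z | exists2 s, in_field s & z = poly_value s].

Lemma poly_values_field c : F c -> poly_values c.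
Proof.
move=> Fc; exists [:: c]; last by rewrite /poly_value /= mulr0 addr0.
by case.
Qed.

Lemma poly_valuesX z : poly_values z -> poly_values (t * z).
Proof.
move=> [s Fs ->]; exists (0 :: s); last by rewrite /poly_value /= add0r.
by apply/in_field_cons; split=> //; apply: subfield0.
Qed.

Lemma poly_valuesD y z : poly_values y -> poly_values z -> poly_values (y + z).
Proof.
move=> [s Fs ->] [s' Fs' ->]; elim: s s' Fs Fs' => [|c s IHs] [|c' s'] Fs Fs'.
- by exists [::] => //; rewrite /poly_value /= addr0.
- by exists (c' :: s') => //; rewrite /poly_value /= add0r.
- by exists (c :: s) => //; rewrite /poly_value /= addr0.
move/in_field_cons: Fs => [Fc Fs]; move/in_field_cons: Fs' => [Fc' Fs'].
have [s2 Fs2 e] := IHs s' Fs Fs'.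
exists (c + c' :: s2); first by apply/in_field_cons; split=> //; apply: (subfieldD sF).
rewrite /poly_value /= -!/(poly_value _) -e; ring.
Qed.

Lemma poly_valuesZ c z : F c -> poly_values z -> poly_values (c * z).
Proof.
move=> Fc [s Fs ->]; exists [seq c * a | a <- s].
  move=> i; rewrite size_map => lt; rewrite (nth_map 0) //.
  by case: sF => _ _ FM _; apply: FM => //; apply: Fs.
elim: s {Fs} => [|a s IHs]; first by rewrite /poly_value /= mulr0.
by rewrite /poly_value /= -!/(poly_value _) -IHs; ring.
Qed.

Lemma poly_valuesM y z : poly_values y -> poly_values z -> poly_values (y * z).
Proof.
move=> [s Fs ->] Pz; elim: s Fs => [|c s IHs] Fs.
  rewrite /poly_value /= mul0r; apply: poly_values_field; exact: subfield0.
move/in_field_cons: Fs => [Fc /IHs Ps].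
rewrite /poly_value /= -/(poly_value _) mulrDl -mulrA.
by apply: poly_valuesD; [exact: poly_valuesZ|exact: poly_valuesX].
Qed.

Lemma poly_value_sum s : poly_value s = \sum_(i < size s) s`_i * t ^+ i.
Proof.
elim: s => [|c s IHs]; first by rewrite big_ord0.
rewrite /poly_value /= -/(poly_value _) IHs big_ord_recl /= mulr1 mulr_sumr.
by congr (_ + _); apply: eq_bigr => i _; rewrite exprS; ring.
Qed.

Definition algebraic_mod := exists s i, [/\ in_field s, (i < size s)%N, s`_i <> 0 &
  J (poly_value s)].

Lemma algebraic_modP : algebraic_mod -> exists s u,
  [/\ in_field s, F u, u <> 0 & J (poly_value s + u * t ^+ size s)].
Proof.
move=> [s [i [Fs si nz Js]]].
elim/last_ind: s Fs si nz Js => [//|s c IHs] Fs si nz.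
have [Fs' Fc] : in_field s /\ F c.
  split=> [j lt|].
    have := Fs j; rewrite size_rcons nth_rcons lt; apply.
    by rewrite ltnS ltnW.
  by have := Fs (size s); rewrite size_rcons nth_rcons ltnn eqxx; apply.
rewrite poly_value_sum size_rcons big_ord_recr /= nth_rcons ltnn eqxx.
have -> : \sum_(j < size s) (rcons s c)`_j * t ^+ j = poly_value s.
  by rewrite poly_value_sum; apply: eq_bigr => j _; rewrite nth_rcons ltn_ord.
have [c0|/eqP c0] := eqVneq c 0; last by exists s, c.
rewrite c0 mul0r addr0; move: si nz; rewrite size_rcons nth_rcons ltnS leq_eqVlt.
case: eqP => [->|_ /= si]; first by rewrite ltnn.
by rewrite si; apply: IHs.
Qed.

(** The products [r i * t^e], with [e] below the degree of the relation, span a set stable under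
    multiplication by [t]. *)
Lemma finite_adjoin (T : finType) (r : T -> D) : algebraic_mod ->
  spans F J r 1 -> (forall y z, spans F J r y -> spans F J r z -> spans F J r (y * z)) ->
  exists (T' : finType) (r' : T' -> D), [/\ spans F J r' 1,
    forall y z, spans F J r' y -> spans F J r' z -> spans F J r' (y * z),
    spans F J r `<=` spans F J r' & spans F J r' t].
Proof.
move=> /algebraic_modP[s [u [Fs Fu u0 Ju]]] M1 MM.
have [v Fv vu] := subfieldV sF Fu u0.
(* In degree zero the relation puts a unit in [J], so everything is spanned. *)
have [s0|sn0] := posnP (size s).
  have J1 : J 1.
    rewrite -vu; apply: ideal_mul => //; move: Ju.
    by rewrite poly_value_sum s0 big_ord0 add0r mulr1.
  exists T, r; split=> //; apply: (spans_ideal sF).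
  by rewrite -[t]mulr1; apply: ideal_mul.
pose r' (i : T * 'I_(size s)) := r i.1 * t ^+ i.2.
pose M' := spans F J r'; exists (T * 'I_(size s))%type, r'.
have A m e : (e < size s)%N -> spans F J r m -> M' (m * t ^+ e).
  move=> es [c [Fc Jc]].
  apply: (spans_mod sF iJ (y := \sum_i c i * (r i * t ^+ e))).
    under eq_bigr do rewrite mulrA.
    by rewrite -mulr_suml -mulrBl; apply: ideal_mulr.
  apply: (spans_sum sF iJ) => i _; apply: (spansZ sF iJ) => //.
  exact: (spans_gen sF iJ r' (i, Ordinal es)).
have X z : M' z -> M' (t * z).
  move=> [c [Fc Jc]]; apply: (spans_mod sF iJ (y := t * \sum_i c i * r' i)).
    by rewrite -mulrBr; apply: ideal_mul.
  rewrite mulr_sumr; apply: (spans_sum sF iJ) => -[i e] _ /=.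
  rewrite mulrCA; apply: (spansZ sF iJ) => //; rewrite /r' /=.
  have [lt|ge] := ltnP e.+1 (size s).
    rewrite mulrCA -exprS; apply: A => //; exact: spans_gen.
  have ee : e.+1 = size s by apply/eqP; rewrite eqn_leq ge ltn_ord.
  (* The top power of [t] is eliminated by the relation divided by its leading coefficient [u]. *)
  apply: (spans_mod sF iJ (y := - v * \sum_(j < size s) s`_j * (r i * t ^+ j))).
    rewrite (_ : _ - _ = v * r i * (poly_value s + u * t ^+ size s)).
      exact: ideal_mul.
    rewrite mulrCA -exprS ee poly_value_sum.
    have -> : \sum_(j < size s) s`_j * (r i * t ^+ j) = r i * \sum_(j < size s) s`_j * t ^+ j.
      by rewrite mulr_sumr; apply: eq_bigr => j _; ring.
    transitivity (v * u * r i * t ^+ size s + v * r i * \sum_(j < size s) s`_j * t ^+ j).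
      by rewrite vu; ring.
    by ring.
  apply: (spansZ sF iJ); first exact: subfieldN.
  apply: (spans_sum sF iJ) => j _; apply: (spansZ sF iJ); first exact: Fs.
  exact: (spans_gen sF iJ r' (i, j)).
have sub : spans F J r `<=` M'.
  by move=> m Mm; rewrite -[m]mulr1 -(expr0 t); apply: A.
have XX e m : spans F J r m -> M' (m * t ^+ e).
  elim: e => [|e IHe] Mm; first by rewrite expr0 mulr1; apply: sub.
  by rewrite exprS mulrCA; apply: X; apply: IHe.
split=> //; first exact: sub.
- apply: (spansM sF iJ) => -[i e] [j e'].
  rewrite /r' /= mulrACA -exprD; apply: XX; apply: MM; exact: spans_gen.
- by rewrite -[t]mulr1; apply: X; apply: sub.
Qed.

End PolynomialValues.

Section CoefficientField.
Variables (D : comPzRingType) (F0 J : set D).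
Hypotheses (sF0 : is_subfield F0) (iJ : is_ideal J).
Hypothesis local : forall z, ~ J z -> exists u, u * z = 1.

(** If [t] were transcendental modulo [J], nonzero polynomials in [t] would avoid [J], hence be
    invertible, and [F(t)] would enlarge a maximal [F]. Inseparability may keep [F] from mapping
    onto the residue field, so only algebraicity is claimed. *)
Lemma coefficient_field : (1 : D) <> 0 -> exists F, [/\ is_subfield F, F0 `<=` F &
  forall t, algebraic_mod F J t].
Proof.
move=> nz.
(* The empty set is allowed so that the empty chain has an upper bound. *)
pose P (F : set D) := F = set0 \/ (is_subfield F /\ F0 `<=` F).
have [|F [PF maxF]] := @Zorn_bigcup D P.
  move=> C CP Ctot; have [[K CK K0]|none] := pselect (exists2 K, C K & K !=set0);
    last first.
    left; apply/seteqP; split=> // z [K CK Kz]; case: none; exists K => //.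
    by exists z.
  right; have good K' : C K' -> forall z, K' z -> is_subfield K' /\ F0 `<=` K'.
    by move=> CK' z K'z; case: (CP _ CK') => // e; rewrite e in K'z.
  have [z Kz] := K0; have [sK F0K] := good _ CK _ Kz.
  have join a b : (\bigcup_(X in C) X) a -> (\bigcup_(X in C) X) b ->
      exists X, [/\ C X, is_subfield X, X a & X b].
    move=> [X CX Xa] [Y CY Yb].
    have [sX _] := good _ CX _ Xa; have [sY _] := good _ CY _ Yb.
    by case: (Ctot _ _ CX CY) => sub; [exists Y|exists X]; split=> //; apply: sub.
  split; last by move=> y /F0K Ky; exists K.
  split.
  - by exists K => //; apply: subfield1.
  - by move=> a b Ca Cb; have [X [CX sX Xa Xb]] := join a b Ca Cb;
      exists X => //; apply: subfieldB.
  - by move=> a b Ca Cb; have [X [CX sX Xa Xb]] := join a b Ca Cb;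
      exists X => //; apply: subfieldM.
  - move=> a Ca a0; have [X [CX sX Xa _]] := join a a Ca Ca.
    by have [y Xy e] := subfieldV sX Xa a0; exists y => //; exists X.
have [sF F0F] : is_subfield F /\ F0 `<=` F.
  case: PF => // e; exfalso; apply: (maxF F0); last by right; split.
  rewrite e; split; first exact: sub0set.
  by move=> /(_ 1 (subfield1 sF0)).
exists F; split=> // t; apply: contrapT => trans.
have PV y : poly_values F t y -> y <> 0 -> exists u, u * y = 1.
  move=> [s Fs ->] y0; apply: local => Js; apply: trans.
  have [i si snz] : exists2 i, (i < size s)%N & s`_i <> 0.
    apply: contrapT => none; apply: y0; rewrite poly_value_sum big1 // => i _.
    rewrite (_ : s`_i = 0) ?mul0r //; apply: contrapT => nzi; apply: none.
    by exists i.
  by exists s, i.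
have F1 := subfield1 sF.
have P1 : poly_values F t 1 by apply: poly_values_field.
have PB y z : poly_values F t y -> poly_values F t z -> poly_values F t (y - z).
  move=> Py Pz; apply: poly_valuesD => //; rewrite -mulN1r.
  by apply: poly_valuesZ => //; apply: (subfieldN sF).
have PM y z : poly_values F t y -> poly_values F t z -> poly_values F t (y * z).
  exact: poly_valuesM.
have sF' := fraction_subfield P1 PB PM PV.
set F' := [set z | _] in sF'.
have PF' y : poly_values F t y -> F' y by move=> Py; exists y, 1, 1; rewrite !mulr1.
have FF' : F `<=` F' by move=> y Fy; apply: PF'; apply: poly_values_field.
have Ft : F t.
  apply: contrapT => nFt; apply: (maxF F'); last by right; split=> // y /F0F/FF'.
  have := poly_valuesX sF P1; rewrite mulr1 => Pt.
  by split=> // /(_ t) h; apply/nFt/h/PF'.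
apply: trans; exists [:: - t; 1], 1%N; split=> //.
  by case=> [|[|//]] _ //=; apply: (subfieldN sF).
rewrite /poly_value /= mulr0 addr0 mulr1 addNr; exact: ideal_zero.
Qed.

End CoefficientField.

(** * Algebras essentially of finite type *)

Section EssentiallyFiniteType.
Variables (k : fieldType) (n : nat) (R : comPzRingType).
Variable tau : {rmorphism {mpoly k[n]} -> R}.
Hypothesis tauP : forall r, exists a s u, tau s * u = 1 /\ r * tau s = tau a.

Lemma noeth_eft : noeth R.
Proof. exact: noeth_image tauP (@noeth_mpoly k n). Qed.

(** The residue field is generated over [F] by the images of the variables, each algebraic;
    adjoining them in turn keeps a finite spanning family, and finiteness already provides the
    inverses of denominators. *)
Lemma finite_start (p : prime_ideal R) :
  exists F : set (localization p (@RAlg R R idfun)),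
    is_subfield F /\ finite_over F (ext (ideal_of_prime p)).
Proof.
set R0 := @RAlg R R idfun; set D := localization p R0.
have iJ := @extP _ D (ideal_of_prime p); set J := ext _ in iJ *.
have loc0 (z : D) : ~ J z -> exists u, u * z = 1.
  move=> nJ; have [s [a [ns e]]] := loc_num z.
  have [u eu] := loc_unit R0 ns.
  have [pa|npa] := pselect (prime_set p a).
    case: nJ; rewrite -[z]mul1r -eu -mulrA e; apply: ideal_mul => //.
    by rewrite -[a]/(ralg_map R0 a) -loc_map_ralg; apply: mem_ext.
  have [v ev] := loc_unit R0 npa.
  by exists (v * ralg_map D s); rewrite -mulrA e -ev.
have [z1|nz] := pselect ((1 : D) = 0).
  exists setT; split.
    split=> // x _; case; by rewrite -[x]mulr1 z1 mulr0.
  exists void, (of_void _) => a; exists (of_void _); split=> //.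
  by rewrite -[_ - _]mulr1 z1 mulr0; apply: ideal_zero.
pose sg : {rmorphism {mpoly k[n]} -> D} := ralg_map D \o tau.
pose F0 : set D := [set sg c%:MP | c in setT].
have sF0 : is_subfield F0.
  split.
  - by exists 1 => //; rewrite !rmorph1.
  - by move=> _ _ [c _ <-] [d _ <-]; exists (c - d) => //; rewrite !rmorphB.
  - by move=> _ _ [c _ <-] [d _ <-]; exists (c * d) => //; rewrite !rmorphM.
  - move=> _ [c _ <-] c0; exists (sg (c^-1)%:MP); first by exists c^-1.
    rewrite -!rmorphM mulVf ?rmorph1 //.
    by apply/eqP => e; apply: c0; rewrite e !rmorph0.
have [F [sF F0F alg]] := coefficient_field sF0 iJ loc0 nz.
have [T [r [M1 MM MX]]] : exists (T : finType) (r : T -> D), [/\ spans F J r 1,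
    forall y z, spans F J r y -> spans F J r z -> spans F J r (y * z) &
    forall i, (i \in enum 'I_n) -> spans F J r (sg 'X_i)].
  elim: (enum 'I_n) => [|i l [T [r [M1 MM MX]]]].
    exists unit, (fun _ : unit => 1).
    have M1 : spans F J (fun _ : unit => 1 : D) (1 : D).
      exact: (spans_gen sF iJ (fun _ : unit => 1 : D) tt).
    by split=> //; apply: (spansM sF iJ) => _ _; rewrite mulr1.
  have [T' [r' [M1' MM' sub Mi]]] := finite_adjoin sF iJ (alg (sg 'X_i)) M1 MM.
  exists T', r'; split=> // j; rewrite inE => /orP[/eqP -> //|/MX].
  exact: sub.
pose M := spans F J r.
have Msg f : M (sg f).
  rewrite [f]mpolyE rmorph_sum; apply: (spans_sum sF iJ) => m _.
  rewrite -mul_mpolyC rmorphM; apply: (spansZ sF iJ).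
    by apply: F0F; exists f@_m.
  rewrite mpolyXE_id rmorph_prod; apply: (big_ind M) => //.
  move=> i _; rewrite rmorphXn; elim: (m i) => [|e IHe]; first by rewrite expr0.
  by rewrite exprS; apply: MM => //; apply: MX; rewrite mem_enum.
have MR x : M (ralg_map D x).
  have [a [s [u [su e]]]] := tauP x.
  rewrite -[x]mulr1 -su mulrA e rmorphM; apply: (MM); first exact: (Msg a).
  apply: (spans_inv sF iJ MM M1 (Msg s)).
  by rewrite /sg /= -rmorphM mulrC su rmorph1.
exists F; split=> //; exists T, r => d.
have [s [a [ns e]]] := loc_num d; have [u eu] := loc_unit R0 ns.
rewrite -[d]mul1r -eu -mulrA e; apply: (MM); last exact: (MR a).
exact: (spans_inv sF iJ MM M1 (MR s) eu).
Qed.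

Fixpoint saturated_chain (p : prime_ideal R) (l : seq (prime_ideal R)) : Prop :=
  if l is p2 :: l' then (p `<` p2 /\
    ~ exists q : prime_ideal R, p `<` q /\ q `<` p2) /\ saturated_chain p2 l'
  else True.

Lemma finite_chain p l : saturated_chain p l ->
  exists F : set (completion_chain (p :: l) (@RAlg R R idfun)),
    is_subfield F /\ finite_over F (ext (ideal_of_prime p)).
Proof.
have nR := noeth_eft.
elim: l p => [|p2 l IHl] p.
  by move=> _; have [F [sF fF]] := finite_start p; apply: (finite_completion nR sF fF).
move=> [[pp2 sat] /IHl[F [sF fF]]].
have [F' [sF' fF']] := finite_step nR sF fF pp2 sat.
exact: (finite_completion nR sF' fF').
Qed.

Lemma saturated_semilocal p l : saturated_chain p l ->
  semilocal (completion_chain (p :: l) (@RAlg R R idfun)).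
Proof. by move=> /finite_chain[F [sF fF]]; apply: finite_semilocal fF. Qed.

(* The value of a polynomial of size at most m is a combination of the finitely
   many values of monomials of degree less than m. *)
Definition degree_filtration (m : nat) : set R :=
  [set z | exists2 f : {mpoly k[n]}, (msize f <= m)%N & z = tau f].

(** Otherwise there are polynomials [v i] of bounded size with [tau (v i)] in the ideal of level
    [lev i] but not in the next chosen one. They satisfy a linear relation, which puts the term of
    least index in that next ideal. *)
Lemma degree_filtration_fin : finite_filtration degree_filtration.
Proof.
split.
- by move=> m m' mm' z [f sf ->]; exists f => //; apply: leq_trans mm'.
- move=> r; have [a [s [u [su e]]]] := tauP r.
  exists (msize a), (tau s), u; split; first by rewrite mulrC.
  by exists a => //; rewrite mulrC.
move=> m K iK Kdec; apply: contrapT => none.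
have mono i j : (i <= j)%N -> K j `<=` K i.
  elim: j => [|j IHj]; first by rewrite leqn0 => /eqP ->.
  rewrite leq_eqVlt => /orP[/eqP -> //|]; rewrite ltnS => /IHj sub.
  by apply: subset_trans sub.
have ex N : exists Mv : nat * {mpoly k[n]}, [/\ (N < Mv.1)%N, (msize Mv.2 <= m)%N,
    K N (tau Mv.2) & ~ K Mv.1 (tau Mv.2)].
  apply: contrapT => H; apply: none; exists N => v [f sf ->] KN M.
  apply: contrapT => nK; apply: H; exists (M, f); split=> //=.
  by rewrite ltnNge; apply/negP => MN; apply: nK; apply: mono MN _ KN.
have [next Hnext] := choice ex.
pose lev := fix lev i := if i is i'.+1 then (next (lev i')).1 else 0%N.
pose v i := (next (lev i)).2.
have vK i : K (lev i) (tau (v i)) by case: (Hnext (lev i)).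
have vnK i : ~ K (lev i.+1) (tau (v i)) by case: (Hnext (lev i)).
have vs i : (msize (v i) <= m)%N by case: (Hnext (lev i)).
have levS i j : (i <= j)%N -> (lev i <= lev j)%N.
  elim: j => [|j IHj]; first by rewrite leqn0 => /eqP ->.
  rewrite leq_eqVlt => /orP[/eqP -> //|]; rewrite ltnS => /IHj le.
  by apply: leq_trans le _; case: (Hnext (lev j)) => lt _ _ _; apply: ltnW.
pose T := 'X_{1..n < m}.
pose w := #|{: T}|.
pose C : 'M[k]_(w.+1, w) := \matrix_(j, i) (v j)@_(bmnm (enum_val i)).
have : kermx C != 0.
  rewrite -mxrank_eq0 mxrank_ker -lt0n subn_gt0 ltnS; exact: rank_leq_col.
move=> /rowV0Pn[u /sub_kermxP uC u0].
have rel : \sum_(j < w.+1) u 0 j *: v j = 0.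
  apply/mpolyP => mm; rewrite mcoeff0 linear_sum /=.
  have [lt|ge] := ltnP (mdeg mm) m; last first.
    rewrite big1 // => j _; rewrite mcoeffZ memN_msupp_eq0 ?mulr0 //.
    exact: msize_mdeg_ge (leq_trans (vs j) ge).
  pose b : T := BMultinom lt.
  transitivity ((u *m C) 0 (enum_rank b)); last by rewrite uC mxE.
  rewrite mxE; apply: eq_bigr => j _.
  by rewrite mcoeffZ mxE enum_rankK.
have {u0} [j0 uj0] : exists j, u 0 j != 0.
  by apply/existsP; apply: contraNT u0 => /existsPn H; apply/eqP/rowP => j;
     rewrite mxE; apply/eqP; rewrite -[_ == _]negbK H.
case: (@arg_minnP _ j0 (fun j => u 0 j != 0) (@nat_of_ord _) uj0) => j1 uj1 minj.
apply: (vnK j1); have iKl := iK (lev j1.+1).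
have -> : tau (v j1) = - \sum_(j < w.+1 | j != j1)
    tau (u 0 j / u 0 j1)%:MP * tau (v j).
  move: rel; rewrite (bigD1 j1) //= => /(congr1 (fun f => tau ((u 0 j1)^-1%:MP * f))).
  rewrite mulr0 rmorph0 mulrDr mul_mpolyC scalerA mulVf // scale1r rmorphD.
  move=> /eqP; rewrite addr_eq0 => /eqP ->; congr (- _).
  rewrite mulr_sumr rmorph_sum; apply: eq_bigr => j _.
  by rewrite -rmorphM !mul_mpolyC scalerA mulrC.
apply: ideal_opp => //; apply: ideal_sum => // j jj1.
have [uj|uj] := eqVneq (u 0 j) 0.
  by rewrite uj mul0r !rmorph0 mul0r; apply: ideal_zero.
apply: ideal_mul => //; apply: mono (vK j); apply: levS.
rewrite ltn_neqAle minj // andbT; apply: contraNneq jj1 => e.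
by apply/eqP; apply: val_inj; rewrite /= e.
Qed.

End EssentiallyFiniteType.

(** * Flags as lists, and the equivalence *)

Section Flags.
Variable R : comPzRingType.
Implicit Types (p : prime_ideal R) (s l : seq (prime_ideal R)).

Lemma is_chain_nth p0 p l :
  (forall j, (j < size l)%N -> nth p0 (p :: l) j `<` nth p0 (p :: l) j.+1) ->
  is_chain p l.
Proof.
elim: l p => [//|p2 l IHl] p H; split; first exact: (H 0%N).
by apply: IHl => j lt; apply: (H j.+1).
Qed.

Lemma saturated_chain_nth p0 p l :
  (forall j, (j < size l)%N -> nth p0 (p :: l) j `<` nth p0 (p :: l) j.+1 /\
    ~ exists q : prime_ideal R, nth p0 (p :: l) j `<` q /\ q `<` nth p0 (p :: l) j.+1) ->
  saturated_chain p l.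
Proof.
elim: l p => [//|p2 l IHl] p H; split; first exact: (H 0%N).
by apply: IHl => j lt; apply: (H j.+1).
Qed.

End Flags.

(** All that is used of [ess_finite_type]: elements of [R] are fractions of images of
    polynomials. *)
Lemma eft_presentation (k : fieldType) (R : comAlgType k) : ess_finite_type R ->
  exists n (tau : {rmorphism {mpoly k[n]} -> R}),
    forall r, exists a s u, tau s * u = 1 /\ r * tau s = tau a.
Proof.
move=> [A [T [phi [[n [psi psi_surj]] [g phiK gK] _]]]].
pose tau : {rmorphism {mpoly k[n]} -> R} := phi \o @to_loc A T \o psi.
exists n, tau => r; rewrite -[r]gK; elim/lfracW: (g r) => a t.
have [f ef] := psi_surj a; have [h eh] := psi_surj (val t).
exists f, h, (phi (lfrac 1 t)); rewrite /tau /= ef eh -!rmorphM; split.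
  rewrite -[RHS](rmorph1 phi); congr (phi _).
  rewrite -[LHS]/(loc_mul _ _) loc_mulE; apply: lfrac_eq => /=; ring.
congr (phi _); rewrite -[LHS]/(loc_mul _ _) loc_mulE; apply: lfrac_eq => /=; ring.
Qed.

Theorem theorem3p7 (k : fieldType) (R : comAlgType k)
    (R_eft : ess_finite_type R) (n : nat)
    (Delta : 'I_n.+1 -> prime_ideal R) (Delta_flag : is_flag Delta) :
  semilocal (ind_pro_completion Delta) <-> saturated Delta.
Proof.
have [m [tau tauP]] := eft_presentation R_eft.
pose L := [seq Delta i | i <- enum 'I_n.+1].
have -> : ind_pro_completion Delta = completion_chain L (@RAlg R R idfun) by [].
have sL : size L = n.+1 by rewrite size_map size_enum_ord.
pose d := Delta ord0.
have nthL i : nth d L i = Delta (inord i) \/ (n < i)%N.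
  have [lt|] := ltnP i n.+1; last by right.
  left; rewrite (nth_map ord0) ?size_enum_ord //; congr Delta; apply: val_inj.
  by rewrite /= nth_enum_ord // inordK.
have {}nthL (i : 'I_n.+1) : nth d L i = Delta i.
  by case: (nthL i) => [->|]; [rewrite inord_val|rewrite ltnNge -ltnS ltn_ord].
have step j : (j < n)%N -> exists i i' : 'I_n.+1,
    [/\ i' = i.+1 :> nat, nth d L j = Delta i & nth d L j.+1 = Delta i'].
  move=> lt; exists (Ordinal (ltnW lt : (j < n.+1)%N)), (Ordinal (lt : (j.+1 < n.+1)%N)).
  by rewrite -!nthL.
have flag j : (j < n)%N -> nth d L j `<` nth d L j.+1.
  by move=> /step[i [i' [e -> ->]]]; apply: Delta_flag.
split=> [|sat]; last first.
  case: L sL {nthL} step flag => [//|p l] [sl] step flag.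
  apply: (saturated_semilocal tauP); apply: (saturated_chain_nth (p0 := d)) => j.
  rewrite sl => lt; split; first exact: flag.
  by have [i [i' [e -> ->]]] := step j lt; apply: sat.
apply: contraPP => /existsNP[i /existsNP[i' /not_implyP[e /contrapT[q [iq qi']]]]].
have lti : (i < n)%N by rewrite -ltnS -e ltn_ord.
(* The flag is cut at the gap: the lower part ends in [Delta i], the upper part begins with
   [Delta i']. *)
rewrite -(cat_take_drop i.+1 L) /completion_chain foldr_cat -!/(completion_chain _ _).
rewrite (take_nth d) ?sL // nthL (drop_nth d) ?sL // -e nthL.
apply: (not_semilocal (noeth_eft tauP) (degree_filtration_fin tauP) _ _ iq qi').
- have : forall j, (j < i)%N -> nth d (rcons (take i L) (Delta i)) j `<`
      nth d (rcons (take i L) (Delta i)) j.+1.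
    move=> j ji; rewrite -nthL -take_nth ?sL // !nth_take ?ltnS //; last exact: ltnW.
    by apply: flag; apply: ltn_trans lti.
  have : size (rcons (take i L) (Delta i)) = i.+1.
    by rewrite size_rcons size_takel // sL ltnW.
  case: (rcons _ _) => [//|p l] [sl] H; apply: (is_chain_nth (p0 := d)) => j.
  by rewrite sl; apply: H.
- apply: (is_chain_nth (p0 := d)) => j.
  rewrite -nthL -drop_nth ?sL // size_drop sL => lt; rewrite !nth_drop addnS.
  by apply: flag; rewrite e in lt *; lia.
Qed.
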